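(* There is an $O(n^2m^2+n^3)$ time algorithm that for any matrix $A\in\mathbb{R}^{m\times n}$ (of full row rank, $n\ge 3$), with $W=\ker(A)$, computes an estimate $\xi$ of $\bar\chi_W$ such that \[ \xi\le \bar\chi_W\le n(\bar\chi_W^* )^2\,\xi \] and a positive diagonal matrix $D\in\mathbb{R}^{n\times n}$ such that \[ \bar\chi_W^*\le\bar\chi_{DW}\le n(\bar\chi_W^* )^3 . \]
   Context: Let $\mathbf D$ denote the set of all positive $n\times n$ diagonal matrices, and $\|\cdot\|$ the Euclidean norm / $\ell_2\to\ell_2$ operator norm. For a matrix $A\in\mathbb{R}^{m\times n}$ of full row rank, the condition number is \[ \bar\chi_A=\sup\{\|A^\top(ADA^\top)^{-1}AD\| : D\in\mathbf D\}. \] It depends only on the subspace $W=\ker(A)$, so one writes $\bar\chi_W:=\bar\chi_A$ for any full-row-rank matrix $A$ with $\ker(A)=W$. For $D\in\mathbf D$, $DW=\{Dx:x\in W\}$, so that $\bar\chi_{DW}=\bar\chi_{AD^{-1}}$, and \[ \bar\chi^*_W=\bar\chi^*_A=\inf\{\bar\chi_{DW}:D\in\mathbf D\}. \] Computational model: the real model of computation, where basic arithmetic operations $+,-,\times,/$, comparisons, and (exact) square roots each take unit time. *)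

(* Defs.v *)
From HB Require Import structures.
From mathcomp Require Import all_boot all_order all_algebra.
From mathcomp Require Import all_classical all_reals ereal.

Set Implicit Arguments.
Unset Strict Implicit.
Unset Printing Implicit Defensive.

Import Order.TTheory GRing.Theory Num.Theory.

Local Open Scope classical_set_scope.
Local Open Scope ring_scope.

Section ConditionNumber.
Variable R : realType.

Definition l2norm n (x : 'cV[R]_n) : R := Num.sqrt (\sum_i x i 0 ^+ 2).

(* Suprema and infima are taken in the extended reals, so that no default value
   for unbounded sets is involved. *)
Definition opnorm m n (M : 'M[R]_(m, n)) : \bar R :=
  ereal_sup [set (l2norm (M *m x))%:E | x in [set x | l2norm x <= 1]].

Definition posdiag n : set 'M[R]_n :=
  [set D | is_diag_mx D /\ forall i, 0 < D i i].

Definition chibar m n (A : 'M[R]_(m, n)) : \bar R :=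
  ereal_sup [set opnorm (A^T *m invmx (A *m D *m A^T) *m A *m D)
            | D in @posdiag n].

Definition kerset m n (A : 'M[R]_(m, n)) : set 'cV[R]_n :=
  [set x | A *m x = 0].

(* The common value of [chibar A] over all full-row-rank [A] with kernel [W]:
   see [chibar_kerset] and [chibarW_kerset] below.  The default 0 is only used
   when [W] is not a linear subspace. *)
Definition chibarW n (W : set 'cV[R]_n) : \bar R :=
  xget 0%E [set c | exists m (A : 'M[R]_(m, n)),
                      [/\ row_free A, kerset A = W & c = chibar A]].

Definition chibar_star n (W : set 'cV[R]_n) : \bar R :=
  ereal_inf [set chibarW (mulmx D @` W) | D in @posdiag n].

Lemma posdiag_form_eq0 n (D : 'M[R]_n) (v : 'rV_n) :
  posdiag D -> v *m D *m v^T = 0 -> v = 0.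
Proof.
move=> [/is_diag_mxP Ddiag Dpos] /rowP /(_ 0); rewrite !mxE.
have vDv j : (v *m D) 0 j * v^T j 0 = D j j * v 0 j ^+ 2.
  rewrite !mxE (bigD1 j) //= big1 => [|k kj]; last by rewrite Ddiag ?mulr0.
  by rewrite addr0 mulrAC -expr2 mulrC.
under eq_bigr do rewrite vDv.
move/eqP; rewrite psumr_eq0 => [/allP v0|j _]; last first.
  by rewrite mulr_ge0 ?sqr_ge0 ?(ltW (Dpos j)).
apply/rowP => j; apply/eqP; have := v0 j (mem_index_enum j).
by rewrite /= mulf_eq0 sqrf_eq0 (gt_eqF (Dpos j)) mxE.
Qed.

Lemma posdiag_gram_unit m n (A : 'M[R]_(m, n)) D :
  row_free A -> posdiag D -> A *m D *m A^T \in unitmx.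
Proof.
move=> Afree Dpos; rewrite -row_free_unit -kermx_eq0.
apply/rowV0P => u /sub_kermxP uM0; apply/eqP.
rewrite -(mulmx_free_eq0 u Afree); apply/eqP; apply: (posdiag_form_eq0 Dpos).
by rewrite trmx_mul mulmxA -(mulmxA u) -(mulmxA u) uM0 mul0mx.
Qed.

Lemma kerset_submx m1 m2 n (A : 'M[R]_(m1, n)) (B : 'M[R]_(m2, n)) :
  kerset A `<=` kerset B -> (B <= A)%MS.
Proof.
move=> sub; rewrite submxE; apply/eqP/matrixP => i j.
have /sub : kerset A (col j (cokermx A)).
  by rewrite /kerset /= colE mulmxA mulmx_coker mul0mx.
by rewrite /kerset /= colE mulmxA -colE => /colP /(_ i); rewrite !mxE.
Qed.

Lemma chibar_kerset m1 m2 n (A : 'M[R]_(m1, n)) (B : 'M[R]_(m2, n)) :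
  row_free A -> row_free B -> kerset A = kerset B -> chibar A = chibar B.
Proof.
move=> Af Bf eqK.
have sBA : (B <= A)%MS by apply: kerset_submx; rewrite eqK.
have sAB : (A <= B)%MS by apply: kerset_submx; rewrite eqK.
have em : m1 = m2.
  apply/eqP; move/eqP: (Af) => <-; move/eqP: (Bf) => <-.
  by rewrite eqn_leq !mxrankS.
subst m2; have /submxP[T BE] := sBA.
have Tu : T \in unitmx.
  rewrite -row_free_unit /row_free eqn_leq rank_leq_row /=.
  by move/eqP: (Bf) => {1}<-; rewrite BE mxrankM_maxl.
congr ereal_sup; apply: eq_imagel => D Dp.
have Gu := posdiag_gram_unit Af Dp.
rewrite BE trmx_mul !mulmxA.
have -> : T *m A *m D *m A^T *m T^T = T *m (A *m D *m A^T) *m T^T.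
  by rewrite !mulmxA.
move: (A *m D *m A^T) Gu => G Gu.
have TTu : T^T \in unitmx by rewrite unitmx_tr.
have -> : invmx (T *m G *m T^T) = invmx T^T *m invmx G *m invmx T.
  have XY : (invmx T^T *m invmx G *m invmx T) *m (T *m G *m T^T) = 1%:M.
    by rewrite !mulmxA mulmxKV // mulmxKV // mulVmx.
  have Uu : T *m G *m T^T \in unitmx by rewrite !unitmx_mul Tu Gu TTu.
  by rewrite -[RHS](mulmxK Uu) XY mul1mx.
by rewrite !mulmxA mulmxK // mulmxKV.
Qed.

Lemma chibarW_kerset m n (A : 'M[R]_(m, n)) :
  row_free A -> chibarW (kerset A) = chibar A.
Proof.
move=> Af; rewrite /chibarW; case: xgetP => [c _ [m' [B [Bf eqK ->]]]|].
  exact: chibar_kerset.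
by move=> /(_ (chibar A)) []; exists m, A.
Qed.

End ConditionNumber.

(* The real model of computation: while-programs over two memories, one of
   natural numbers (used for indices) and one of reals.  Each memory consists of
   arrays, named by constants of the program text (so that a program uses
   finitely many of them), each with cells indexed by the natural numbers; a
   scalar variable is cell 0 of an array.  There is no conversion between the
   two memories, no rounding, and no integer division.  The syntax does not
   depend on the field, and the only real constants are natural numbers. *)
Inductive iexp :=
  | IConst of nat
  | IGet of nat & iexp
  | IAdd of iexp & iexp
  | ISub of iexp & iexp
  | IMul of iexp & iexp.

Inductive rexp :=
  | RConst of nat
  | RGet of nat & iexp
  | RAdd of rexp & rexp
  | RSub of rexp & rexp
  | RMul of rexp & rexp
  | RDiv of rexp & rexp
  | RSqrt of rexp.

Inductive bexp :=
  | ILe of iexp & iexp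
  | RLe of rexp & rexp
  | BNot of bexp
  | BAnd of bexp & bexp.

Inductive cmd :=
  | Skip
  | ISet of nat & iexp & iexp
  | RSet of nat & iexp & rexp
  | Seq of cmd & cmd
  | If of bexp & cmd & cmd
  | While of bexp & cmd.

(* Each memory access and each operation takes unit time. *)
Fixpoint icost (e : iexp) : nat :=
  match e with
  | IConst _ => 1
  | IGet _ e => (icost e).+1
  | IAdd e f | ISub e f | IMul e f => (icost e + icost f).+1
  end.

Fixpoint rcost (e : rexp) : nat :=
  match e with
  | RConst _ => 1
  | RGet _ e => (icost e).+1
  | RAdd e f | RSub e f | RMul e f | RDiv e f => (rcost e + rcost f).+1
  | RSqrt e => (rcost e).+1
  end.

Fixpoint bcost (b : bexp) : nat :=
  match b with
  | ILe e f => (icost e + icost f).+1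
  | RLe e f => (rcost e + rcost f).+1
  | BNot b => (bcost b).+1
  | BAnd b c => (bcost b + bcost c).+1
  end.

Section Semantics.
Variable R : realType.

Record state := State {
  imem : nat -> nat -> nat;
  rmem : nat -> nat -> R
}.

Definition update T (f : nat -> nat -> T) (a k : nat) (v : T) : nat -> nat -> T :=
  fun a' k' => if (a' == a) && (k' == k) then v else f a' k'.

Fixpoint ieval (s : state) (e : iexp) : nat :=
  match e with
  | IConst k => k
  | IGet a e => imem s a (ieval s e)
  | IAdd e f => (ieval s e + ieval s f)%N
  | ISub e f => (ieval s e - ieval s f)%N
  | IMul e f => (ieval s e * ieval s f)%N
  end.

(* Subtraction of indices is truncated at 0.  Below, [x / 0] and the square root
   of a negative number evaluate to 0; as a program can test for these cases
   with one comparison, this convention gives it no additional power. *)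
Fixpoint reval (s : state) (e : rexp) : R :=
  match e with
  | RConst k => k%:R
  | RGet a e => rmem s a (ieval s e)
  | RAdd e f => reval s e + reval s f
  | RSub e f => reval s e - reval s f
  | RMul e f => reval s e * reval s f
  | RDiv e f => reval s e / reval s f
  | RSqrt e => Num.sqrt (reval s e)
  end.

Fixpoint beval (s : state) (b : bexp) : bool :=
  match b with
  | ILe e f => (ieval s e <= ieval s f)%N
  | RLe e f => reval s e <= reval s f
  | BNot b => ~~ beval s b
  | BAnd b c => beval s b && beval s c
  end.

(* [exec c s t s']: started in state [s], the program [c] terminates in state
   [s'] after [t] units of time. *)
Inductive exec : cmd -> state -> nat -> state -> Prop :=
  | exec_skip s : exec Skip s 1 s
  | exec_iset s a i e :
      exec (ISet a i e) s (icost i + icost e).+1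
           (State (update (imem s) a (ieval s i) (ieval s e)) (rmem s))
  | exec_rset s a i e :
      exec (RSet a i e) s (icost i + rcost e).+1
           (State (imem s) (update (rmem s) a (ieval s i) (reval s e)))
  | exec_seq c1 c2 s s1 s2 t1 t2 :
      exec c1 s t1 s1 -> exec c2 s1 t2 s2 ->
      exec (Seq c1 c2) s (t1 + t2) s2
  | exec_if b c1 c2 s s1 t :
      exec (if beval s b then c1 else c2) s t s1 ->
      exec (If b c1 c2) s (bcost b + t) s1
  | exec_while_false b c s :
      ~~ beval s b -> exec (While b c) s (bcost b) s
  | exec_while_true b c s s1 s2 t1 t2 :
      beval s b -> exec c s t1 s1 -> exec (While b c) s1 t2 s2 ->
      exec (While b c) s (bcost b + t1 + t2) s2.

(* Input: the dimensions are in cells 0 and 1 of index array 0, and the matrix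
   is stored row by row in real array 0.  The other cells have arbitrary
   contents. *)
Definition input m n (A : 'M[R]_(m, n)) (s : state) : Prop :=
  [/\ imem s 0 0 = m, imem s 0 1 = n &
      forall (i : 'I_m) (j : 'I_n), rmem s 0 (i * n + j) = A i j].

(* Output: the estimate is in cell 0 of real array 1, and the diagonal of the
   scaling matrix is in the first [n] cells of real array 2. *)
Definition output_xi (s : state) : R := rmem s 1 0.

Definition output_diag n (s : state) : 'M[R]_n :=
  diag_mx (\row_(j < n) rmem s 2 j).

End Semantics.

(* Main.v *)
Require Import Defs.
From mathcomp Require Import all_boot all_order all_algebra.
From mathcomp Require Import all_classical all_reals ereal.
From mathcomp Require Import zify ring lra.

(** Write [P = A^T (A D A^T)^-1 A D], called [wproj A D] below, for the matrices
    whose norms define [chibar A].  The proof works with single entries of [P].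
    The operator norm of [P] is at most [n] times its largest entry, and no entry
    exceeds the norm.  Rescaling the kernel [W] by a positive diagonal [e]
    conjugates [P] by [e], so that [|P i j| e_j / e_i] is at most the condition
    number of [e W], for every [e].  Multiplying such bounds along a closed walk of
    [k] indices cancels the weights [e], and the product of the entries is at most
    the [k]-th power of the optimal condition number [chibar_star W].

    The algorithm computes for each pair [i, j] a number [w_ij] such that entries
    [P i j], for suitable weights [D], come arbitrarily close to [w_ij], and
    entries [P j i] to [1 / w_ij].  Then [w_ij <= chibar A], while the closed walk
    [i, j] gives [|P i j| <= w_ij chibar_star^2] for all [D].  Hence the largest
    [w_ij] is the required estimate.  For the scaling, fix an index [r] in each
    connected component and put [d_j = 1 / w_rj].  The entries of the rescaled
    projection are [|P i j| d_j / d_i = |P i j| w_jr w_ri], and the closed walk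
    [i, j, r] bounds them by [chibar_star^3].  So a scaling read off from a single
    index [r] of each component suffices.

    A certificate for [w_ij] is a kernel vector [g] and a vector [u] of the row
    space whose supports meet in [i] and [j] only; then [w_ij = |g_j / g_i|]
    ([ratio_witness], [ratio_witness_le]).  To find certificates, bring the matrix
    to Gauss-Jordan form and regard its non-zero pattern as a bipartite graph on
    rows and columns.  A shortest path from column [i] to column [j] has no chords,
    so the equations defining [g] and [u] can be solved one edge at a time, and
    [w_ij] is the alternating product of the entries along the path.  A
    breadth-first search computes these products for all [j] at once
    ([search_inv_step], [search_witness]).  If no path joins [i] to [j], then
    [P i j = 0] for all [D] ([wproj_block0]).

    Elimination takes time [m^2 n], which is at most [n^3].  A search consists of
    [m] rounds, each scanning the [m] by [n] matrix twice, since every round but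
    the last ones reaches a new row; over the [n] sources this is [n^2 m^2]. *)

Set Implicit Arguments.
Unset Strict Implicit.
Unset Printing Implicit Defensive.

Import Order.TTheory GRing.Theory Num.Theory.

Local Open Scope ring_scope.

(** * Euclidean and operator norms *)

Section Norms.
Variable R : realType.

Lemma l2norm_ge0 n (x : 'cV[R]_n) : 0 <= l2norm x.
Proof. exact: sqrtr_ge0. Qed.

Lemma sqr_l2norm n (x : 'cV[R]_n) : l2norm x ^+ 2 = \sum_i x i 0 ^+ 2.
Proof. by rewrite sqr_sqrtr // sumr_ge0 // => i _; rewrite sqr_ge0. Qed.

Lemma l2normZ n (a : R) (x : 'cV[R]_n) : l2norm (a *: x) = `|a| * l2norm x.
Proof.
rewrite /l2norm; under eq_bigr do rewrite mxE exprMn.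
by rewrite -mulr_sumr sqrtrM ?sqr_ge0 // sqrtr_sqr.
Qed.

Lemma l2norm_eq0 n (x : 'cV[R]_n) : l2norm x = 0 -> x = 0.
Proof.
move=> x0; have := sqr_l2norm x; rewrite x0 expr0n /= => /esym/eqP.
rewrite psumr_eq0 => [/allP z|i _]; last exact: sqr_ge0.
apply/colP => i; rewrite mxE; apply/eqP.
by have := z i (mem_index_enum i); rewrite /= sqrf_eq0.
Qed.

Lemma ler_norm_l2norm n (x : 'cV[R]_n) i : `|x i 0| <= l2norm x.
Proof.
rewrite -sqrtr_sqr ler_sqrt; last by apply: sumr_ge0 => k _; exact: sqr_ge0.
by rewrite (bigD1 i) //= lerDl sumr_ge0 // => k _; exact: sqr_ge0.
Qed.

Lemma l2norm_delta n (j : 'I_n) : l2norm (delta_mx j 0 : 'cV[R]_n) = 1.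
Proof.
rewrite /l2norm (bigD1 j) //= big1 => [|k kj]; last first.
  by rewrite mxE (negbTE kj) expr0n.
by rewrite mxE !eqxx expr1n addr0 sqrtr1.
Qed.

Lemma l2norm_le_opnorm m n (P : 'M[R]_(m, n)) x :
  l2norm x <= 1 -> ((l2norm (P *m x))%:E <= opnorm P)%E.
Proof. by move=> x1; apply: ereal_sup_ubound; exists x. Qed.

Lemma entry_le_opnorm m n (P : 'M[R]_(m, n)) i j : (`|P i j|%:E <= opnorm P)%E.
Proof.
apply: le_trans (@l2norm_le_opnorm _ _ P (delta_mx j 0) _); last first.
  by rewrite l2norm_delta.
rewrite lee_fin; apply: le_trans (ler_norm_l2norm _ i).
by rewrite -colE mxE.
Qed.

(** Cauchy-Schwarz against the all-ones vector, from the sum of the squares of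
    the differences of absolute values. *)
Lemma sum_norm_sqr_le n (x : 'cV[R]_n) :
  (\sum_j `|x j 0|) ^+ 2 <= n%:R * \sum_j x j 0 ^+ 2.
Proof.
have : 0 <= \sum_i \sum_j (`|x i 0| - `|x j 0|) ^+ 2.
  by apply: sumr_ge0 => i _; apply: sumr_ge0 => j _; exact: sqr_ge0.
set S := \sum_j `|x j 0|; set Q := \sum_j x j 0 ^+ 2.
have -> : \sum_i \sum_j (`|x i 0| - `|x j 0|) ^+ 2 =
  \sum_i (x i 0 ^+ 2 *+ n - (`|x i 0| * S) *+ 2 + Q).
  apply: eq_bigr => i _.
  rewrite (eq_bigr (fun j => x i 0 ^+ 2 - `|x i 0| * `|x j 0| *+ 2 + x j 0 ^+ 2)).
    by rewrite big_split /= sumrB sumr_const card_ord sumrMnl -mulr_sumr.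
  by move=> j _; rewrite sqrrB !real_normK ?num_real.
rewrite big_split /= sumrB sumr_const card_ord !sumrMnl -mulr_suml -/S -/Q.
by move: S Q => S Q; rewrite -(mulr_natl Q) -(mulr_natl (S * S)); lra.
Qed.

(** An entrywise bound controls the Frobenius norm, hence the operator norm. *)
Lemma opnorm_le_entry n (P : 'M[R]_n) (c : R) :
  0 <= c -> (forall i j, `|P i j| <= c) -> (opnorm P <= (n%:R * c)%:E)%E.
Proof.
move=> c0 Pc; apply: ge_ereal_sup => _ [x /= x1 <-].
rewrite lee_fin -(@ler_pXn2r _ 2) ?nnegrE ?l2norm_ge0 ?mulr_ge0 //.
rewrite sqr_l2norm.
have row_le i : (P *m x) i 0 ^+ 2 <= n%:R * c ^+ 2.
  have -> : (P *m x) i 0 ^+ 2 = `|(P *m x) i 0| ^+ 2.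
    by rewrite real_normK ?num_real.
  have le1 : `|(P *m x) i 0| <= c * \sum_j `|x j 0|.
    rewrite mxE mulr_sumr; apply: le_trans (ler_norm_sum _ _ _) _.
    by apply: ler_sum => j _; rewrite normrM ler_wpM2r.
  apply: (@le_trans _ _ ((c * \sum_j `|x j 0|) ^+ 2)).
    by rewrite ler_pXn2r ?nnegrE ?mulr_ge0 // sumr_ge0.
  rewrite exprMn mulrC ler_wpM2r ?sqr_ge0 //.
  apply: le_trans (sum_norm_sqr_le _) _.
  rewrite -[leRHS]mulr1 ler_wpM2l // -sqr_l2norm.
  by rewrite -(expr1n _ 2%N) ler_pXn2r ?nnegrE ?l2norm_ge0.
apply: le_trans (ler_sum _ (fun i _ => row_le i)) _.
by rewrite sumr_const card_ord -(mulr_natl (_ * _)) exprMn mulrA -expr2.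
Qed.

(** A non-zero column of an idempotent matrix is fixed by it. *)
Lemma opnorm_idem_ge1 n (P : 'M[R]_n) :
  P *m P = P -> P != 0 -> (1 <= opnorm P)%E.
Proof.
move=> PP Pn0.
have [j Pj] : exists j, col j P != 0.
  apply/existsP; apply: contraNT Pn0 => /existsPn P0; apply/eqP/matrixP => i j.
  by have /negPn/eqP/colP/(_ i) := P0 j; rewrite !mxE.
have v0 : 0 < l2norm (col j P).
  by rewrite lt_def l2norm_ge0 andbT; apply: contraNneq Pj => /l2norm_eq0 ->.
have nx : l2norm ((l2norm (col j P))^-1 *: col j P) = 1.
  by rewrite l2normZ gtr0_norm ?invr_gt0 // mulVf ?gt_eqF.
have n1 : l2norm ((l2norm (col j P))^-1 *: col j P) <= 1 by rewrite nx.
have := l2norm_le_opnorm P n1.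
by rewrite -scalemxAr colE mulmxA PP -colE nx.
Qed.

End Norms.

(** * Weighted projections and their entries *)

Section WeightedProjection.
Variable R : realType.

Definition wproj m n (A : 'M[R]_(m, n)) (D : 'M[R]_n) : 'M[R]_n :=
  A^T *m invmx (A *m D *m A^T) *m A *m D.

Lemma diag_posdiag n (d : 'rV[R]_n) : (forall i, 0 < d 0 i) -> posdiag (diag_mx d).
Proof.
move=> d0; split=> [|i]; first exact: diag_mx_is_diag.
by rewrite mxE eqxx mulr1n.
Qed.

Lemma posdiag1 n : posdiag (1%:M : 'M[R]_n).
Proof. by rewrite -diag_const_mx; apply: diag_posdiag => i; rewrite mxE. Qed.

Lemma posdiagP n (D : 'M[R]_n) :
  posdiag D -> exists2 d : 'rV_n, D = diag_mx d & forall i, 0 < d 0 i.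
Proof.
case=> /is_diag_mxP Dd D0; exists (\row_i D i i) => [|i]; last by rewrite mxE.
apply/matrixP => i j; rewrite !mxE; case: eqVneq => [->|ij] /=.
  by rewrite mulr1n.
by rewrite mulr0n Dd.
Qed.

Definition dinv n (d : 'rV[R]_n) : 'rV[R]_n := map_mx GRing.inv d.

Lemma dinvE n (d : 'rV[R]_n) i : dinv d 0 i = (d 0 i)^-1.
Proof. by rewrite mxE. Qed.

Lemma dinv_gt0 n (d : 'rV[R]_n) :
  (forall i, 0 < d 0 i) -> forall i, 0 < dinv d 0 i.
Proof. by move=> d0 i; rewrite mxE invr_gt0. Qed.

Lemma diag_dinv n (d : 'rV[R]_n) :
  (forall i, 0 < d 0 i) -> diag_mx d *m diag_mx (dinv d) = 1%:M.
Proof.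
move=> d0; rewrite mulmx_diag -diag_const_mx; congr diag_mx.
by apply/rowP => i; rewrite !mxE divff ?gt_eqF.
Qed.

Lemma dinv_diag n (d : 'rV[R]_n) :
  (forall i, 0 < d 0 i) -> diag_mx (dinv d) *m diag_mx d = 1%:M.
Proof. by move=> d0; apply: mulmx1C; exact: diag_dinv. Qed.

Lemma row_free_scale m n (A : 'M[R]_(m, n)) (d : 'rV[R]_n) :
  row_free A -> (forall i, 0 < d 0 i) -> row_free (A *m diag_mx (dinv d)).
Proof.
move=> Af d0; rewrite /row_free mxrankMfree ?(eqP Af) //.
by rewrite row_free_unit; case/mulmx1_unit: (dinv_diag d0).
Qed.

Lemma chibarW_scale m n (A : 'M[R]_(m, n)) (d : 'rV[R]_n) :
  row_free A -> (forall i, 0 < d 0 i) ->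
  chibarW (mulmx (diag_mx d) @` kerset A)%classic = chibar (A *m diag_mx (dinv d)).
Proof.
move=> Af d0.
have -> : (mulmx (diag_mx d) @` kerset A)%classic = kerset (A *m diag_mx (dinv d)).
  apply/seteqP; split=> x /=.
    case=> y; rewrite /kerset /= => Ay <-.
    by rewrite mulmxA -(mulmxA A) dinv_diag // mulmx1.
  rewrite /kerset /= => Ax; exists (diag_mx (dinv d) *m x).
    by rewrite /kerset /= mulmxA.
  by rewrite mulmxA diag_dinv // mul1mx.
by rewrite chibarW_kerset // row_free_scale.
Qed.

Lemma opnorm_wproj_le m n (A : 'M[R]_(m, n)) D :
  posdiag D -> (opnorm (wproj A D) <= chibar A)%E.
Proof. by move=> Dp; apply: ereal_sup_ubound; exists D. Qed.

(** Conjugation by [e] absorbs the rescaling of the kernel once the weights are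
    changed to [e D e]; since these run over all positive weights, no generality is
    lost. *)
Lemma wproj_scale m n (A : 'M[R]_(m, n)) (D : 'M[R]_n) (e : 'rV[R]_n) :
  (forall i, 0 < e 0 i) ->
  wproj (A *m diag_mx (dinv e)) (diag_mx e *m D *m diag_mx e) =
  diag_mx (dinv e) *m wproj A D *m diag_mx e.
Proof.
move=> e0; rewrite /wproj trmx_mul tr_diag_mx.
set E := diag_mx e; set F := diag_mx (dinv e).
have FE : F *m E = 1%:M by exact: dinv_diag.
have EF : E *m F = 1%:M by exact: diag_dinv.
have -> : A *m F *m (E *m D *m E) *m (F *m A^T) = A *m D *m A^T.
  by rewrite !mulmxA -(mulmxA A) FE mulmx1 -(mulmxA _ E F) EF mulmx1.
by rewrite !mulmxA -[_ *m A *m F *m E]mulmxA FE mulmx1.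
Qed.

Lemma mul_diagr m n (A : 'M[R]_(m, n)) (d : 'rV[R]_n) i j :
  (A *m diag_mx d) i j = A i j * d 0 j.
Proof. by rewrite mul_mx_diag mxE. Qed.

Lemma mul_diagl m n (A : 'M[R]_(m, n)) (d : 'rV[R]_m) i j :
  (diag_mx d *m A) i j = d 0 i * A i j.
Proof. by rewrite mul_diag_mx mxE. Qed.

Lemma wproj_entry_scale m n (A : 'M[R]_(m, n)) D (e : 'rV[R]_n) i j :
  posdiag D -> (forall i, 0 < e 0 i) ->
  (`|wproj A D i j * (e 0 j / e 0 i)|%:E <= chibar (A *m diag_mx (dinv e)))%E.
Proof.
move=> Dp e0; set D' := diag_mx e *m D *m diag_mx e.
have D'p : posdiag D'.
  have [d Dd d0] := posdiagP Dp; split=> [|k].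
    by rewrite /D' Dd !mulmx_diag; exact: diag_mx_is_diag.
  by rewrite /D' Dd mul_diagr mul_diagl !mulr_gt0 // mxE eqxx mulr1n.
apply: le_trans (opnorm_wproj_le _ D'p); apply: le_trans (entry_le_opnorm _ i j).
rewrite wproj_scale // mul_diagr mul_diagl dinvE lee_fin.
by rewrite (mulrC (e 0 i)^-1) mulrA mulrAC.
Qed.

Lemma chibar_le_entry m n (A : 'M[R]_(m, n)) (c : R) : 0 <= c ->
  (forall D i j, posdiag D -> `|wproj A D i j| <= c) ->
  (chibar A <= (n%:R * c)%:E)%E.
Proof.
move=> c0 Ac; apply: ge_ereal_sup => _ [D Dp <-].
by apply: opnorm_le_entry => // i j; exact: Ac.
Qed.

Section FullRowRank.
Variables (m n : nat) (A : 'M[R]_(m, n)) (D : 'M[R]_n).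
Hypotheses (Af : row_free A) (Dp : posdiag D).

Lemma mulmx_wproj : A *m D *m wproj A D = A *m D.
Proof.
have Gu := posdiag_gram_unit Af Dp.
by rewrite /wproj !mulmxA mulmxV // mul1mx.
Qed.

Lemma wproj_tr : wproj A D *m A^T = A^T.
Proof.
have Gu := posdiag_gram_unit Af Dp.
by rewrite /wproj -!mulmxA [A *m (D *m _)]mulmxA mulVmx // mulmx1.
Qed.

Lemma wproj_idem : wproj A D *m wproj A D = wproj A D.
Proof.
by rewrite {2}/wproj !mulmxA wproj_tr.
Qed.

Lemma opnorm_wproj_ge1 : (0 < m)%N -> (1 <= opnorm (wproj A D))%E.
Proof.
move=> m0; apply: opnorm_idem_ge1; first exact: wproj_idem.
apply: contraTneq m0 => P0.
have := wproj_tr; rewrite P0 mul0mx => /esym A0.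
by move: Af; rewrite /row_free -mxrank_tr A0 mxrank0 => /eqP <-.
Qed.

(** The map [wproj A D] is the orthogonal projection onto the row space for the
    inner product with weights [D]. *)
Lemma wproj_contract (v : 'cV[R]_n) :
  \sum_k D k k * (wproj A D *m v) k 0 ^+ 2 <= \sum_k D k k * v k 0 ^+ 2.
Proof.
have [d Dd d0] := posdiagP Dp.
set p := wproj A D *m v.
have formE (x y : 'cV[R]_n) : (x^T *m D *m y) 0 0 = \sum_k D k k * (x k 0 * y k 0).
  rewrite mxE; apply: eq_bigr => k _.
  by rewrite Dd mul_diagr !mxE eqxx mulr1n; ring.
have orth : p^T *m D *m (v - p) = 0.
  pose q := invmx (A *m D *m A^T) *m A *m D *m v.
  have -> : p^T *m D *m (v - p) = q^T *m (A *m D *m v - A *m D *m p).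
    have -> : p^T = q^T *m A by rewrite -[A in RHS]trmxK -trmx_mul /q /p /wproj !mulmxA.
    by rewrite -!mulmxA -!mulmxBr.
  by rewrite /p [A *m D *m (_ *m v)]mulmxA mulmx_wproj subrr mulmx0.
have ortho0 : \sum_k D k k * (p k 0 * (v k 0 - p k 0)) = 0.
  transitivity ((p^T *m D *m (v - p)) 0 0); last by rewrite orth mxE.
  by rewrite formE; apply: eq_bigr => k _; rewrite !mxE.
have splitv k : D k k * v k 0 ^+ 2 - D k k * p k 0 ^+ 2 =
  2%:R * (D k k * (p k 0 * (v k 0 - p k 0))) + D k k * (v k 0 - p k 0) ^+ 2.
  by ring.
rewrite -subr_ge0 -sumrB (eq_bigr _ (fun k _ => splitv k)) big_split /=.
rewrite -mulr_sumr ortho0 mulr0 add0r sumr_ge0 // => k _.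
by rewrite mulr_ge0 ?sqr_ge0 //; case: Dp => _ /(_ k)/ltW.
Qed.

End FullRowRank.

Lemma chibar_ge1 m n (A : 'M[R]_(m, n)) :
  row_free A -> (0 < m)%N -> (1 <= chibar A)%E.
Proof.
move=> Af m0; apply: le_trans (opnorm_wproj_le _ (posdiag1 n)).
exact: opnorm_wproj_ge1 Af (posdiag1 n) m0.
Qed.

(** If the entries of [A] join only rows in [T] to columns in [S] and rows
    outside [T] to columns outside [S], then [A] is block diagonal, and the
    coordinate projection onto [S] commutes with [wproj A D]. *)
Lemma wproj_block0 m n (A : 'M[R]_(m, n)) D (S : {set 'I_n}) (T : {set 'I_m}) i j :
  row_free A -> posdiag D ->
  (forall k c, A k c != 0 -> (k \in T) = (c \in S)) ->
  i \in S -> j \notin S -> wproj A D i j = 0.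
Proof.
move=> Af Dp ST iS jS.
pose P : 'M[R]_n := diag_mx (\row_c (c \in S)%:R).
pose Q : 'M[R]_m := diag_mx (\row_k (k \in T)%:R).
have QA : Q *m A = A *m P.
  apply/matrixP => k c; rewrite mul_diagl mul_diagr !mxE.
  by have [->|/ST ->] := eqVneq (A k c) 0; rewrite ?mulr0 ?mul0r // mulrC.
have AQ : A^T *m Q = P *m A^T.
  have := congr1 trmx QA; rewrite !trmx_mul.
  by rewrite !tr_diag_mx.
have [d Dd d0] := posdiagP Dp.
have PD : P *m D = D *m P by rewrite Dd; exact: diag_mxC.
have Gu := posdiag_gram_unit Af Dp.
have QG : Q *m (A *m D *m A^T) = A *m D *m A^T *m Q.
  by rewrite !mulmxA QA -!mulmxA AQ (mulmxA P) PD -mulmxA.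
have QGi : Q *m invmx (A *m D *m A^T) = invmx (A *m D *m A^T) *m Q.
  apply: (can_inj (mulKmx Gu)); rewrite mulmxA -QG mulmxK //.
  by rewrite mulKVmx.
have PW : P *m wproj A D = wproj A D *m P.
  rewrite /wproj !mulmxA -AQ -(mulmxA _ Q) QGi -!mulmxA (mulmxA Q A) QA.
  by rewrite -!mulmxA PD.
have := congr1 (fun M : 'M_n => M i j) PW.
rewrite mul_diagl mul_diagr !mxE iS (negbTE jS) mul1r mulr0.
exact.
Qed.

(** Up to the positive column factors [D j j], the matrix [wproj A D] is
    symmetric. *)
Lemma wproj_sym0 m n (A : 'M[R]_(m, n)) D i j : row_free A ->
  posdiag D -> wproj A D i j = 0 -> wproj A D j i = 0.
Proof.
move=> Af Dp; have [d Dd d0] := posdiagP Dp.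
have Gs : (A^T *m invmx (A *m D *m A^T) *m A)^T = A^T *m invmx (A *m D *m A^T) *m A.
  by rewrite !trmx_mul trmx_inv !trmx_mul trmxK Dd tr_diag_mx !mulmxA.
rewrite /wproj {2 4}Dd !mul_diagr => /eqP; rewrite mulf_eq0 (gt_eqF (d0 j)) orbF.
by move/eqP=> Xij; rewrite -Gs mxE Xij mul0r.
Qed.

(** A certificate that [w] is approached by entries [(i, j)] of weighted
    projections, and [w^-1] by entries [(j, i)].  It generalizes the ratio of two
    entries of a circuit: there every choice of [i] and [j] in the support of [g]
    has a suitable [u].  The case [i = j] makes the bounds below uniform. *)
Definition ratio_witness m n (A : 'M[R]_(m, n)) (i j : 'I_n) (w : R) : Prop :=
  (i = j /\ w = 1) \/
  exists (g : 'cV[R]_n) (u : 'rV[R]_m),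
    [/\ i != j, A *m g = 0,
        forall l, (g l 0 * (u *m A) 0 l != 0) = (l \in pred2 i j)
      & w = `|g j 0 / g i 0|].

Lemma ratio_witness_gt0 m n (A : 'M[R]_(m, n)) i j w :
  ratio_witness A i j w -> 0 < w.
Proof.
case=> [[_ ->]|[g [u [ij _ gu ->]]]]; first exact: ltr01.
have:= gu i; have := gu j; rewrite !inE !eqxx orbT /= !mulf_eq0 !negb_or.
by case/andP=> gj _ /andP[gi _]; rewrite normr_gt0 mulf_neq0 ?invr_eq0.
Qed.

Lemma ratio_witness_sym m n (A : 'M[R]_(m, n)) i j w :
  ratio_witness A i j w -> ratio_witness A j i w^-1.
Proof.
case=> [[-> ->]|[g [u [ij Ag gu ->]]]]; first by left; rewrite invr1.
right; exists g, u; split=> //; first by rewrite eq_sym.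
  by move=> l; rewrite gu !inE orbC.
by rewrite -normfV invf_div.
Qed.

Lemma ratio_witness_scale m n (A : 'M[R]_(m, n)) (e : 'rV[R]_n) i j w :
  (forall i, 0 < e 0 i) -> ratio_witness A i j w ->
  ratio_witness (A *m diag_mx (dinv e)) i j (w * (e 0 j / e 0 i)).
Proof.
move=> e0; case=> [[-> ->]|[g [u [ij Ag gu ->]]]].
  by left; rewrite mul1r divff ?gt_eqF.
right; exists (diag_mx e *m g), u; split=> //.
- by rewrite mulmxA -(mulmxA A) dinv_diag // mulmx1.
- move=> l; rewrite -gu mulmxA mul_diagr mul_diagl dinvE.
  by congr (_ != 0); field; rewrite gt_eqF.
- rewrite !mul_diagl -[e 0 j / e 0 i]gtr0_norm ?divr_gt0 // -normrM.
  by rewrite [in RHS]invfM [in RHS]mulrACA [in RHS]mulrC.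
Qed.

(** Let the weights be 1 on the support of [g] without [i], and [t^2] elsewhere.
    Normalize [u] to [u_j = 1].  Then [delta_j - u] has weighted norm [O(t)], and
    since [u] is fixed by the projection, the image [p] of [delta_j] differs from
    [u] by [O(t)] on the support of [g] without [i].  There [u] agrees with
    [delta_j], so that the equation [g . p = 0] forces
    [g_i p_i = - g_j + O(t)], where [p_i] is the entry [(i, j)]. *)
Lemma ratio_witness_le m n (A : 'M[R]_(m, n)) i j w :
  row_free A -> (0 < m)%N -> ratio_witness A i j w -> (w%:E <= chibar A)%E.
Proof.
move=> Af m0 [[_ ->]|]; first exact: chibar_ge1.
case=> g [u0 [ij Ag gu ->]].
have := gu i; have := gu j; rewrite !inE !eqxx orbT /= !mulf_eq0 !negb_or.
case/andP=> gj u0j /andP[gi u0i].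
pose u : 'cV[R]_n := (((u0 *m A) 0 j)^-1 *: (u0 *m A))^T.
have uE D : posdiag D -> wproj A D *m u = u.
  by move=> Dp; rewrite /u linearZ /= trmx_mul -scalemxAr mulmxA wproj_tr.
have ul' l : u l 0 = (u0 *m A) 0 l / (u0 *m A) 0 j by rewrite mxE mxE mulrC.
have uj : u j 0 = 1 by rewrite ul' divff.
have ul l : l != i -> l != j -> g l 0 != 0 -> u l 0 = 0.
  move=> li lj gl; have := gu l; rewrite !inE (negbTE li) (negbTE lj) /=.
  by move/negbFE; rewrite mulf_eq0 (negbTE gl) /= ul' => /eqP ->; rewrite mul0r.
(* The constant of the error term: the entry is within [K t] of the ratio. *)
pose v : 'cV[R]_n := delta_mx j 0 - u.
pose G : R := \sum_k `|g k 0|.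
pose K : R := G * l2norm v / `|g i 0|.
have vE k : v k 0 = (k == j)%:R - u k 0.
  by rewrite [LHS]mxE [X in X + _]mxE [X in _ + X]mxE eqxx andbT.
have v0 k : k != i -> g k 0 != 0 -> v k 0 = 0.
  move=> ki gk; rewrite vE; have [->|kj] := eqVneq k j.
    by rewrite uj subrr.
  by rewrite ul // subrr.
have main (t : R) : 0 < t -> ((`|g j 0 / g i 0| - K * t)%:E <= chibar A)%E.
  move=> t0.
  pose d : 'rV[R]_n := \row_k (if (k != i) && (g k 0 != 0) then 1 else t ^+ 2).
  have d0 k : 0 < d 0 k by rewrite mxE; case: ifP; rewrite ?exprn_gt0.
  have Dp := diag_posdiag d0.
  apply: le_trans (opnorm_wproj_le _ Dp); apply: le_trans (entry_le_opnorm _ i j).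
  rewrite lee_fin.
  pose p : 'cV[R]_n := wproj A (diag_mx d) *m delta_mx j 0.
  have -> : wproj A (diag_mx d) i j = p i 0 by rewrite /p -colE [RHS]mxE.
  pose q := wproj A (diag_mx d) *m v.
  have pE : p = u + q by rewrite /p /q /v mulmxBr uE // addrC subrK.
  have qk k : k != i -> g k 0 != 0 -> `|q k 0| <= t * l2norm v.
    move=> ki gk; rewrite -(@ler_pXn2r _ 2) ?nnegrE ?mulr_ge0 ?l2norm_ge0 ?(ltW t0) //.
    rewrite real_normK ?num_real // exprMn sqr_l2norm mulr_sumr.
    apply: le_trans (_ : \sum_l diag_mx d l l * v l 0 ^+ 2 <= _); last first.
      apply: ler_sum => l _; rewrite mxE eqxx mulr1n mxE.
      by case: ifP => // /andP[li gl]; rewrite v0 // expr0n /= !mulr0.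
    apply: le_trans (wproj_contract Af Dp v); rewrite -/q.
    rewrite (bigD1 k) //= [diag_mx d k k]mxE eqxx mulr1n [d 0 k]mxE ki gk /= mul1r lerDl.
    by apply: sumr_ge0 => l _; rewrite mulr_ge0 ?sqr_ge0 // mxE eqxx mulr1n ltW.
  have gp0 : \sum_k g k 0 * p k 0 = 0.
    transitivity ((g^T *m p) 0 0); last by
      rewrite /p /wproj !mulmxA -trmx_mul Ag trmx0 !mul0mx mxE.
    by rewrite mxE; apply: eq_bigr => k _; rewrite [g^T _ _]mxE.
  have gp : g i 0 * p i 0 + g j 0 = - \sum_(k | k != i) g k 0 * q k 0.
    move: gp0; rewrite (bigD1 i) //=.
    have -> : \sum_(k | k != i) g k 0 * p k 0 = g j 0 + \sum_(k | k != i) g k 0 * q k 0.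
      under eq_bigr do rewrite pE mxE mulrDr.
      rewrite big_split /= (bigD1 j) 1?eq_sym //= uj mulr1 big1 ?addr0 // => k /andP[ki kj].
      by have [->|gk] := eqVneq (g k 0) 0; rewrite ?mul0r // ul ?mulr0.
    by rewrite addrA => /eqP; rewrite addr_eq0 => /eqP.
  have gp_le : `|g i 0 * p i 0 + g j 0| <= \sum_k `|g k 0| * (t * l2norm v).
    rewrite gp normrN; apply: le_trans (ler_norm_sum _ _ _) _.
    rewrite [leRHS](bigD1 i) //= -[leLHS]add0r lerD //.
      by rewrite !mulr_ge0 ?l2norm_ge0 ?(ltW t0).
    apply: ler_sum => k ki; rewrite normrM.
    have [->|gk] := eqVneq (g k 0) 0; first by rewrite normr0 !mul0r.
    by rewrite ler_wpM2l // qk.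
  have gi0 : 0 < `|g i 0| by rewrite normr_gt0.
  rewrite lerBlDr -(ler_pM2l gi0) -normrM [g i 0 * _]mulrC divfK //.
  rewrite mulrDr -normrM.
  apply: le_trans (_ : `|g i 0 * p i 0| + `|g i 0 * p i 0 + g j 0| <= _).
    by have := ler_normB (g i 0 * p i 0 + g j 0) (g i 0 * p i 0); rewrite addrAC subrr add0r addrC.
  rewrite lerD2l; apply: le_trans gp_le _.
  rewrite -mulr_suml -/G [leLHS](_ : _ = `|g i 0| * (K * t)) //.
  by rewrite /K; field; rewrite gt_eqF.
have K0 : 0 <= K.
  by rewrite !mulr_ge0 ?invr_ge0 ?l2norm_ge0 // sumr_ge0.
case: (chibar A) main => [c||] main; last 2 first.
- by rewrite leey.
- by have := main 1 ltr01; rewrite leeNy_eq.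
rewrite lee_fin; apply/ler_addgt0Pr => x x0.
have K1 : 0 < 1 + K by rewrite ltr_pwDl.
have t0 : 0 < x / (1 + K) by rewrite divr_gt0.
have := main _ t0; rewrite lee_fin lerBlDr => /le_trans; apply.
by rewrite lerD2l mulrA ler_pdivrMr // mulrC ler_wpM2l ?(ltW x0) // lerDr.
Qed.

End WeightedProjection.

(** * Bounds by powers of the optimal condition number *)

Section Estimates.
Variable R : realType.

Lemma expy k : (0 < k)%N -> ((+oo : \bar R) ^+ k)%E = +oo%E.
Proof.
case: k => // k _; elim: k => [|k IH]; first by rewrite expeS expe0 mule1.
by rewrite expeS IH mulyy.
Qed.

Lemma le_mul2e (a b : R) (x : \bar R) : 0 <= a -> 0 <= b ->
  (a%:E <= x)%E -> (b%:E <= x)%E -> ((a * b)%:E <= x ^+ 2)%E.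
Proof.
move=> a0 b0; case: x => [x||]; [|by move=> _ _; rewrite expy // leey|by rewrite leeNy_eq].
by rewrite -EFin_expe !lee_fin expr2 => ax bx; rewrite ler_pM.
Qed.

Lemma le_mul3e (a b c : R) (x : \bar R) : 0 <= a -> 0 <= b -> 0 <= c ->
  (a%:E <= x)%E -> (b%:E <= x)%E -> (c%:E <= x)%E ->
  ((a * b * c)%:E <= x ^+ 3)%E.
Proof.
move=> a0 b0 c0; case: x => [x||]; [|by move=> _ _ _; rewrite expy // leey|by rewrite leeNy_eq].
rewrite -EFin_expe !lee_fin !exprS expr0 mulr1 => ax bx cx.
by rewrite mulrA !ler_pM // mulr_ge0.
Qed.

(** Powers commute with infima of non-negative sets; passing to the [k]-th root
    of [a] avoids a continuity argument. *)
Lemma le_ereal_inf_exp (S : set (\bar R)) (a : R) k : (0 < k)%N -> 0 <= a ->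
  (forall x, S x -> (0 <= x)%E /\ (a%:E <= x ^+ k)%E) ->
  (a%:E <= ereal_inf S ^+ k)%E.
Proof.
move=> k0 a0 Sa.
have [y [y0 yk]] : exists y, 0 <= y /\ y ^+ k = a.
  have [||y /andP[y0 _] /rootP] := @poly_ivt R ('X^k - a%:P) 0 (a + 1).
  - by rewrite addr_ge0.
  - rewrite !hornerE expr0n eqn0Ngt k0 /= add0r oppr_le0 a0 /= subr_ge0.
    apply: le_trans (_ : a + 1 <= _); first by rewrite lerDl.
    by rewrite -{1}(expr1 (a + 1)) ler_weXn2l // lerDr.
  rewrite !hornerE => /eqP; rewrite subr_eq0 => /eqP yk.
  by exists y.
have yS : (y%:E <= ereal_inf S)%E.
  apply: le_ereal_inf_tmp => x /Sa[]; case: x => [x||]; last 2 first.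
  - by move=> _ _; rewrite leey.
  - by rewrite leNgt ltNye.
  by rewrite -EFin_expe !lee_fin -yk => x0; rewrite ler_pXn2r.
case: (ereal_inf S) yS => [x||]; [|by move=> _; rewrite expy // leey|by rewrite leeNy_eq].
rewrite -EFin_expe !lee_fin -yk => yx.
by rewrite ler_pXn2r // nnegrE (le_trans y0).
Qed.

Lemma chibar_ge0 m n (A : 'M[R]_(m, n)) : (0 <= chibar A)%E.
Proof.
apply: le_trans (opnorm_wproj_le A (posdiag1 R n)).
apply: le_trans (@l2norm_le_opnorm _ _ _ _ 0 _).
  by rewrite lee_fin l2norm_ge0.
by rewrite -(scale0r 0) l2normZ normr0 mul0r.
Qed.

Section FixedMatrix.
Variables (m n : nat) (A : 'M[R]_(m, n)).
Hypotheses (Af : row_free A) (m0 : (0 < m)%N) (n0 : (0 < n)%N).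

Lemma le_chibar_star_exp (a : R) k : (0 < k)%N -> 0 <= a ->
  (forall e : 'rV_n, (forall i, 0 < e 0 i) ->
     (a%:E <= chibar (A *m diag_mx (dinv e)) ^+ k)%E) ->
  (a%:E <= chibar_star (kerset A) ^+ k)%E.
Proof.
move=> k0 a0 ae; apply: le_ereal_inf_exp => // _ [D Dp <-].
have [e -> e0] := posdiagP Dp.
by rewrite chibarW_scale //; split; [exact: chibar_ge0 | exact: ae].
Qed.

(** The pairs of indices whose entries the two bounds have to control. *)
Definition linked (i j : 'I_n) : Prop :=
  i = j \/ exists2 D, posdiag D & wproj A D i j != 0.

Lemma scaled_witness_le_chibar (e : 'rV[R]_n) i j w :
  (forall i, 0 < e 0 i) -> ratio_witness A i j w ->
  ((w * (e 0 j / e 0 i))%:E <= chibar (A *m diag_mx (dinv e)))%E.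
Proof.
move=> e0 /(ratio_witness_scale e0).
exact: ratio_witness_le (row_free_scale Af e0) m0.
Qed.

(** The closed walk [i, j]: the weights [e] cancel between the entry and the
    reversed certificate. *)
Lemma entry_le_star2 D i j w : posdiag D -> ratio_witness A i j w ->
  ((`|wproj A D i j| / w)%:E <= chibar_star (kerset A) ^+ 2)%E.
Proof.
move=> Dp iw; have w0 := ratio_witness_gt0 iw.
apply: le_chibar_star_exp => // [|e e0]; first by rewrite divr_ge0 // ltW.
have -> : `|wproj A D i j| / w =
  `|wproj A D i j * (e 0 j / e 0 i)| * (w^-1 * (e 0 i / e 0 j)).
  rewrite normrM (gtr0_norm (divr_gt0 _ _)) //; field.
  by rewrite !gt_eqF.
apply: le_mul2e => //; first by rewrite !mulr_ge0 ?invr_ge0 // ltW.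
  exact: wproj_entry_scale.
exact: scaled_witness_le_chibar (ratio_witness_sym iw).
Qed.

(** The same cancellation along the closed walk [i, j, r]. *)
Lemma entry_le_star3 D i j r v w : posdiag D -> ratio_witness A r i v ->
  ratio_witness A r j w ->
  ((`|wproj A D i j * (v / w)|)%:E <= chibar_star (kerset A) ^+ 3)%E.
Proof.
move=> Dp iv jw; have v0 := ratio_witness_gt0 iv; have w0 := ratio_witness_gt0 jw.
apply: le_chibar_star_exp => // e e0.
have -> : `|wproj A D i j * (v / w)| =
  `|wproj A D i j * (e 0 j / e 0 i)| * (w^-1 * (e 0 r / e 0 j)) *
  (v * (e 0 i / e 0 r)).
  rewrite !normrM !normfV (gtr0_norm v0) (gtr0_norm w0) !(gtr0_norm (e0 _)).
  by field; rewrite !gt_eqF.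
apply: le_mul3e => //; try by rewrite !mulr_ge0 ?invr_ge0 // ltW.
- exact: wproj_entry_scale.
- exact: scaled_witness_le_chibar (ratio_witness_sym jw).
- exact: scaled_witness_le_chibar.
Qed.

Lemma star_gt0 : (0 < chibar_star (kerset A))%E.
Proof.
apply: (@lt_le_trans _ _ 1%:E); first by rewrite lte_fin.
have := @le_chibar_star_exp 1 1 isT ler01.
rewrite [X in (_ <= X)%E]expeS expe0 mule1; apply=> e e0; rewrite expeS expe0 mule1.
exact: chibar_ge1 (row_free_scale Af e0) m0.
Qed.

Lemma chibar_le_estimate (xi : R) :
  (forall i j, linked i j -> exists2 w, ratio_witness A i j w & w <= xi) ->
  (chibar A <= n%:R%:E * chibar_star (kerset A) ^+ 2 * xi%:E)%E.
Proof.
move=> Hxi.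
have xi0 : 0 < xi.
  have [] := Hxi (Ordinal n0) (Ordinal n0) (or_introl erefl) => w iw.
  by apply: lt_le_trans; exact: ratio_witness_gt0 iw.
have := entry_le_star2; have := star_gt0.
case: (chibar_star _) => [s||]; last 2 first.
- by rewrite expy // gt0_muley ?lte_fin ?ltr0n // gt0_mulye ?lte_fin // leey.
- by rewrite ltNge leNye.
rewrite lte_fin -EFin_expe -!EFinM => s0 Hs.
rewrite -mulrA; apply: chibar_le_entry => [|D i j Dp].
  by rewrite mulr_ge0 ?ltW // exprn_gt0.
have [->|Pij] := eqVneq (wproj A D i j) 0.
  by rewrite normr0 mulr_ge0 ?ltW // exprn_gt0.
have [|w iw wxi] := Hxi i j; first by right; exists D.
have w0 := ratio_witness_gt0 iw.
have := Hs D i j w Dp iw; rewrite lee_fin ler_pdivrMr // => /le_trans; apply.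
by rewrite ler_pM2l // exprn_gt0.
Qed.

Lemma chibar_scale_le (d : 'rV[R]_n) : (forall i, 0 < d 0 i) ->
  (forall i j, linked i j -> exists r,
     ratio_witness A r i (d 0 i)^-1 /\ ratio_witness A r j (d 0 j)^-1) ->
  (chibar (A *m diag_mx (dinv d)) <= n%:R%:E * chibar_star (kerset A) ^+ 3)%E.
Proof.
move=> d0 Hd; have := entry_le_star3; have := star_gt0.
case: (chibar_star _) => [s||]; last 2 first.
- by rewrite expy // gt0_muley ?lte_fin ?ltr0n // leey.
- by rewrite ltNge leNye.
rewrite lte_fin -EFin_expe -!EFinM => s0 Hs.
apply: chibar_le_entry => [|D i j Dp]; first by rewrite ltW // exprn_gt0.
pose F := diag_mx (dinv d); pose D' := F *m D *m F.
have D'p : posdiag D'.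
  have [c Dc c0] := posdiagP Dp; split=> [|k].
    by rewrite /D' Dc !mulmx_diag; exact: diag_mx_is_diag.
  by rewrite /D' Dc mul_diagr mul_diagl !mulr_gt0 ?dinv_gt0 // mxE eqxx mulr1n.
have DE : D = diag_mx d *m D' *m diag_mx d.
  by rewrite /D' !mulmxA diag_dinv // mul1mx -mulmxA dinv_diag // mulmx1.
rewrite DE wproj_scale // mul_diagr mul_diagl dinvE.
have [->|Pij] := eqVneq (wproj A D' i j) 0.
  by rewrite mulr0 mul0r normr0 ltW // exprn_gt0.
have [|r [ri rj]] := Hd i j; first by right; exists D'.
have := Hs D' i j r _ _ D'p ri rj; rewrite lee_fin invrK.
by rewrite mulrCA mulrA.
Qed.

End FixedMatrix.
End Estimates.

(** * Breadth-first search in the pattern of a reduced matrix *)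

Section Search.
Variable R : realType.

(** The effect of one pass over the labels: a label 0 means unreached, a reached
    label is kept, and an unreached [x] gets its label from some reached
    neighbour [y], if there is one.  Which neighbour is used is left open, as all
    choices are correct. *)
Definition relabel (I J : Type) (E : J -> I -> R) (f : R -> R -> R)
    (src : J -> R) (old new : I -> R) : Prop :=
  forall x, if old x != 0 then new x = old x else
    (new x = 0 /\ forall y, src y != 0 -> E y x = 0) \/
    exists y, [/\ src y != 0, E y x != 0 & new x = f (src y) (E y x)].

Variables (m n : nat) (A : 'M[R]_(m, n)) (i : 'I_n).

Definition row_step (cv : 'I_n -> R) := relabel (fun c r => A r c) *%R cv.
Definition col_step (rv : 'I_m -> R) :=
  relabel (fun r c => A r c) (fun a b => - (a / b)) rv.

Implicit Types (cv : 'I_n -> R) (rv : 'I_m -> R).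

(** The partial solutions carried along a shortest path from the source [i] to
    column [j].  The vector [y] lives on the columns of the path and [z] on its
    rows; the fields retain what extending the path requires.  The entries of
    [A y] vanish on the rows of the path, those of [z A] vanish on its columns
    except at the two ends, and [v] is the entry of [y] at the end.  The
    conditions on the labels express that the path is shortest: all neighbours of
    its earlier columns are already reached, so that a row reached later is
    adjacent to the last column only. *)
Record col_path cv rv (j : 'I_n) (v : R) (y : 'cV[R]_n) (z : 'rV[R]_m) : Prop := ColPath {
  cp_src : y i 0 = 1;
  cp_end : y j 0 = v;
  cp_supp : forall c, y c 0 != 0 -> cv c != 0;
  cp_closed : forall c, c != j -> y c 0 != 0 -> forall r, A r c != 0 -> rv r != 0;
  cp_row : forall r, z 0 r != 0 -> (A *m y) r 0 = 0 /\ rv r != 0;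
  cp_orth : forall c, y c 0 != 0 -> c != i -> c != j -> (z *m A) 0 c = 0;
  cp_ends : if i == j then z = 0 else (z *m A) 0 i != 0 /\ (z *m A) 0 j != 0
}.

(** The same data for a path ending in row [r], where [A y] does not yet vanish;
    its value there becomes the label of [r]. *)
Record row_path cv rv (r : 'I_m) (v : R) (y : 'cV[R]_n) (z : 'rV[R]_m) : Prop := RowPath {
  rp_src : y i 0 = 1;
  rp_end : (A *m y) r 0 = v;
  rp_supp : forall c, y c 0 != 0 -> cv c != 0;
  rp_row : forall k, k != r -> z 0 k != 0 -> (A *m y) k 0 = 0 /\ rv k != 0;
  rp_orth : forall c, y c 0 != 0 -> c != i -> (z *m A) 0 c = 0;
  rp_ends : (z *m A) 0 i != 0 /\ z 0 r != 0
}.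

Record search_inv cv rv : Prop := SearchInv {
  si_src : cv i = 1;
  si_path : forall j, cv j != 0 -> exists y z, col_path cv rv j (cv j) y z;
  si_closed : forall r c, rv r != 0 -> A r c != 0 -> cv c != 0
}.

Lemma search_inv_init : search_inv (fun j => (j == i)%:R) (fun=> 0).
Proof.
split=> [|j|r c]; rewrite ?eqxx //.
case: (eqVneq j i) => [-> _|_]; last by rewrite eqxx.
exists (delta_mx i 0), 0; split; rewrite ?eqxx ?mxE ?eqxx //.
- by move=> c; rewrite !mxE andbT.
- by move=> c /negbTE ci; rewrite mxE ci /= eqxx.
- by move=> r; rewrite mxE eqxx.
- by move=> c _ _ _; rewrite mul0mx mxE.
Qed.

(** Appending row [r] to a path ending in column [c].  Row [r] meets the support of
    [y] in [c] only, so that [(A y)_r = y_c A r c], and a multiple of row [r] is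
    added to [z A] to cancel its entry at [c].  At the source there is nothing to
    cancel, and the multiple is 1. *)
Lemma extend_row cv rv r c : search_inv cv rv -> rv r = 0 -> cv c != 0 -> A r c != 0 ->
  exists y z, row_path cv rv r (cv c * A r c) y z.
Proof.
case=> _ paths cl rv0 cvc Arc.
have [y [z [yi yc ysupp ycl zrow zorth zends]]] := paths c cvc.
have Ar c' : c' != c -> y c' 0 != 0 -> A r c' = 0.
  move=> c'c yc'; apply/eqP/negPn/negP => /(ycl c' c'c yc' r).
  by rewrite rv0 eqxx.
have zr : z 0 r = 0.
  by apply/eqP/negPn/negP => /zrow[_]; rewrite rv0 eqxx.
pose nu := if i == c then 1 else - ((z *m A) 0 c / A r c).
have nu0 : nu != 0.
  rewrite /nu; move: zends; case: eqP => _; first by rewrite oner_eq0.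
  by case=> _ zc; rewrite oppr_eq0 mulf_neq0 ?invr_eq0.
have zA c' : ((z + nu *: delta_mx 0 r) *m A) 0 c' = (z *m A) 0 c' + nu * A r c'.
  by rewrite mulmxDl -scalemxAl mxE [X in _ + X]mxE -rowE [row _ _ _ _]mxE.
have z'E k : (z + nu *: delta_mx 0 r) 0 k = z 0 k + nu * (k == r)%:R.
  by rewrite !mxE eqxx.
exists y, (z + nu *: delta_mx 0 r); split => //.
- rewrite mxE (bigD1 c) //= big1 ?addr0 ?yc 1?mulrC // => c' c'c.
  by have [->|/(Ar c' c'c) ->] := eqVneq (y c' 0) 0; rewrite ?mulr0 ?mul0r.
- by move=> k kr; rewrite z'E (negbTE kr) mulr0 addr0 => /zrow.
- move=> c' yc' c'i; rewrite zA; have [c'c|c'c] := eqVneq c' c.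
    rewrite c'c /nu; case: eqVneq => [ic|_]; last by rewrite mulNr divfK // subrr.
    by move: c'i; rewrite c'c ic eqxx.
  by rewrite Ar // mulr0 addr0 zorth.
- rewrite zA z'E zr add0r eqxx mulr1; split=> //.
  move: zends; rewrite /nu; case: eqVneq => [ic zz|ic [zi _]].
    by rewrite zz mul0mx mxE add0r mul1r ic.
  have Ari : A r i = 0 by apply: Ar; rewrite // yi oner_neq0.
  by rewrite Ari mulr0 addr0.
Qed.

(** Appending column [c] to a path ending in row [r].  Column [c] meets the support
    of [z] in [r] only, so that changing [y] at [c] repairs [(A y)_r = 0] without
    affecting the other rows of the path. *)
Lemma extend_col cv rv cv' rv' r c v :
  (forall k d, rv k != 0 -> A k d != 0 -> cv d != 0) ->
  (forall k d, cv d != 0 -> A k d != 0 -> rv' k != 0) ->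
  (forall k, rv k != 0 -> rv' k != 0) -> (forall d, cv d != 0 -> cv' d != 0) ->
  cv i != 0 -> cv c = 0 -> cv' c != 0 -> rv' r != 0 -> A r c != 0 ->
  (exists y z, row_path cv rv r v y z) ->
  exists y z, col_path cv' rv' c (- (v / A r c)) y z.
Proof.
move=> clr clc rvS cvS cvi cvc cvc' rvr Arc [y [z [yi yr ysupp zrow zorth [zi zr]]]].
have yc : y c 0 = 0 by apply/eqP/negPn/negP => /ysupp; rewrite cvc eqxx.
have ic : i != c by apply: contraNneq cvi => ->; rewrite cvc.
pose a := - (v / A r c).
have y'E d : (y + a *: delta_mx c 0) d 0 = y d 0 + a * (d == c)%:R.
  by rewrite !mxE eqxx andbT.
have Ay k : (A *m (y + a *: delta_mx c 0)) k 0 = (A *m y) k 0 + a * A k c.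
  by rewrite mulmxDr -scalemxAr mxE [X in _ + X]mxE -colE [col _ _ _ _]mxE.
have Akc k : rv k != 0 -> A k c = 0.
  by move=> rvk; apply/eqP/negPn/negP => /(clr k c rvk); rewrite cvc eqxx.
have zAc : (z *m A) 0 c = z 0 r * A r c.
  rewrite mxE (bigD1 r) //= big1 ?addr0 // => k kr.
  by have [->|/(zrow k kr)[_ /Akc ->]] := eqVneq (z 0 k) 0; rewrite ?mul0r ?mulr0.
exists (y + a *: delta_mx c 0), z; split.
- by rewrite y'E (negbTE ic) mulr0 addr0.
- by rewrite y'E yc eqxx mulr1 add0r.
- move=> d; rewrite y'E; have [->|_] := eqVneq d c; first by [].
  by rewrite mulr0 addr0 => /ysupp/cvS.
- move=> d dc; rewrite y'E (negbTE dc) mulr0 addr0 => /ysupp cvd k; exact: clc.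
- move=> k zk; rewrite Ay; have [->|kr] := eqVneq k r.
    by rewrite yr /a mulNr divfK // subrr.
  have [-> rvk] := zrow k kr zk; rewrite Akc // mulr0 addr0; split=> //.
  exact: rvS.
- move=> d; rewrite y'E => yd di dc; move: yd.
  by rewrite (negbTE dc) mulr0 addr0 => yd; exact: zorth.
- by rewrite (negbTE ic) zAc mulf_neq0.
Qed.

Lemma relabel_new (I J : Type) (E : J -> I -> R) f src old new x :
  relabel E f src old new -> old x = 0 -> new x != 0 ->
  exists y, [/\ src y != 0, E y x != 0 & new x = f (src y) (E y x)].
Proof.
by move=> /(_ x) + ox; rewrite ox eqxx /= => -[[-> _]|//]; rewrite eqxx.
Qed.

Lemma relabel_keep (I J : Type) (E : J -> I -> R) f src old new x :
  relabel E f src old new -> old x != 0 -> new x = old x.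
Proof. by move=> /(_ x) + ox; rewrite ox. Qed.

Lemma relabel_reach (I J : Type) (E : J -> I -> R) f src old new x y :
  (forall a b, a != 0 -> b != 0 -> f a b != 0) ->
  relabel E f src old new -> src y != 0 -> E y x != 0 -> new x != 0.
Proof.
move=> f0 /(_ x) + sy Eyx; have [_|ox ->//] := eqVneq (old x) 0.
case=> [[_ /(_ y sy) E0]|[z [sz Ez ->]]]; last exact: f0.
by rewrite E0 eqxx in Eyx.
Qed.

Lemma row_step_reach cv rv rv' r c :
  row_step cv rv rv' -> cv c != 0 -> A r c != 0 -> rv' r != 0.
Proof. by apply: relabel_reach => a b; exact: mulf_neq0. Qed.

Lemma col_step_reach rv cv cv' r c :
  col_step rv cv cv' -> rv r != 0 -> A r c != 0 -> cv' c != 0.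
Proof.
apply: (@relabel_reach _ _ (fun r c => A r c)) => a b a0 b0.
by rewrite oppr_eq0 mulf_neq0 ?invr_eq0.
Qed.

Lemma search_inv_step cv rv cv' rv' : search_inv cv rv ->
  row_step cv rv rv' -> col_step rv' cv cv' -> search_inv cv' rv'.
Proof.
move=> inv rs cs; have [src paths cl] := inv.
have rvS k : rv k != 0 -> rv' k != 0 by move=> rk; rewrite (relabel_keep rs).
have cvS d : cv d != 0 -> cv' d != 0 by move=> cd; rewrite (relabel_keep cs).
have cvi : cv i != 0 by rewrite src oner_neq0.
split=> [|j cvj'|r c rvr Arc]; last exact: col_step_reach cs rvr Arc.
  by rewrite (relabel_keep cs).
have [cvj|cvj] := eqVneq (cv j) 0.
  have [r [rvr Arj ->]] := relabel_new cs cvj cvj'.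
  apply: (@extend_col cv rv) => //.
    by move=> k d cvd Akd; exact: row_step_reach rs cvd Akd.
  have rv0 : rv r = 0.
    by apply/eqP/negPn/negP => /cl/(_ Arj); rewrite cvj eqxx.
  have [c [cvc Arc ->]] := relabel_new rs rv0 rvr.
  exact: extend_row.
have [y [z [yi yj ysupp ycl zrow zorth zends]]] := paths j cvj.
exists y, z; split=> //.
- by rewrite (relabel_keep cs).
- by move=> c /ysupp/cvS.
- by move=> c cj yc r Arc; exact/rvS/(ycl c).
- by move=> r /zrow[? /rvS].
Qed.

Definition marked (I : finType) (f : I -> R) : {set I} := [set x | f x != 0].

Definition closed_labels cv rv :=
  forall r c, A r c != 0 -> (rv r != 0) = (cv c != 0).

(** A round that reaches no new row changes nothing, so that the reached rows and
    columns are closed under adjacency; otherwise the number of reached rows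
    grows. *)
Lemma closed_labels_step cv rv cv' rv' d : search_inv cv rv ->
  row_step cv rv rv' -> col_step rv' cv cv' ->
  closed_labels cv rv \/ (d <= #|marked rv|)%N ->
  closed_labels cv' rv' \/ (d < #|marked rv'|)%N.
Proof.
move=> inv rs cs; have [src paths cl] := inv.
have rvS k : rv k != 0 -> rv' k != 0 by move=> rk; rewrite (relabel_keep rs).
have [/existsP[r /existsP[c /and3P[Arc cvc rvr]]]|none] :=
  boolP [exists r, exists c, [&& A r c != 0, cv c != 0 & rv r == 0]].
  case=> [/(_ r c Arc)|dle]; first by rewrite cvc rvr.
  right; apply: leq_ltn_trans dle _; apply: proper_card; apply/properP; split.
    by apply/fintype.subsetP => k; rewrite !inE; exact: rvS.
  exists r; rewrite inE ?negbK //; exact: row_step_reach rs cvc Arc.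
move=> _; left.
have cl2 r c : A r c != 0 -> cv c != 0 -> rv r != 0.
  move=> Arc cvc; apply: contraNN none => rv0.
  by apply/existsP; exists r; apply/existsP; exists c; rewrite Arc cvc.
have rvE r : (rv' r != 0) = (rv r != 0).
  apply/idP/idP; last exact: rvS.
  have [rv0|//] := eqVneq (rv r) 0.
  by move=> /(relabel_new rs rv0)[c [cvc Arc _]]; move: (cl2 r c Arc cvc); rewrite rv0 eqxx.
have cvE c : (cv' c != 0) = (cv c != 0).
  apply/idP/idP => [|cvc]; last by rewrite (relabel_keep cs).
  have [cv0|//] := eqVneq (cv c) 0.
  move=> /(relabel_new cs cv0)[r [rvr Arc _]].
  by rewrite rvE in rvr; move: (cl r c rvr Arc); rewrite cv0 eqxx.
move=> r c Arc; rewrite rvE cvE; apply/idP/idP => [rvr|]; first exact: cl rvr Arc.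
exact: cl2.
Qed.

Lemma all_rows_closed cv rv : search_inv cv rv ->
  closed_labels cv rv \/ (m <= #|marked rv|)%N -> closed_labels cv rv.
Proof.
move=> [_ _ cl] [//|mle] r c Arc.
have rvr : rv r != 0.
  have /eqP setE : marked rv == [set: 'I_m].
    by rewrite eqEcard finset.subsetT cardsT card_ord.
  have : r \in marked rv by rewrite setE finset.in_setT.
  by rewrite inE.
by rewrite rvr (cl r c rvr Arc).
Qed.

Lemma closed_linked cv rv : row_free A -> closed_labels cv rv ->
  forall a b, linked A a b -> (cv a != 0) = (cv b != 0).
Proof.
move=> Af cl a b [->//|[D Dp Pab]].
have bl x y : wproj A D x y != 0 -> cv x != 0 -> cv y != 0.
  move=> Pxy cvx; apply: contraNT Pxy => cvy; apply/eqP.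
  apply: (@wproj_block0 _ _ _ _ _ (marked cv) (marked rv));
    rewrite ?inE // => r c Arc; rewrite !inE; exact: cl.
apply/idP/idP; apply: bl => //.
by apply: contraNneq Pab => /(wproj_sym0 Af Dp) ->.
Qed.

(** The matrix is reduced up to row scaling: each row has a pivot that is alone in
    its column. *)
Definition has_basis := forall k, exists c, A k c != 0 /\ forall k', k' != k -> A k' c = 0.

(** Subtracting multiples of unit vectors at pivot columns turns [y] into a kernel
    vector [g].  The corrected coordinates belong to rows where [A y] is non-zero,
    hence off the path, where [z A] vanishes at the pivot column; so [g] and [y]
    have the same products with [z A]. *)
Lemma search_witness cv rv j : has_basis -> search_inv cv rv -> cv j != 0 ->
  ratio_witness A i j `|cv j|.
Proof.
move=> hb; have [b bP] := boolp.choice hb; move=> [cvi paths _] cvj.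
have [<-|ij] := eqVneq i j; first by left; rewrite cvi normr1.
right; have [y [z [yi yj ysupp ycl zrow zorth]]] := paths j cvj.
rewrite (negbTE ij) => -[zi zj].
pose q k := (A *m y) k 0 / A k (b k).
pose g := y - \sum_k q k *: delta_mx (b k) 0.
have gE l : g l 0 = y l 0 - \sum_k q k * (l == b k)%:R.
  rewrite !mxE summxE; congr (_ - _); apply: eq_bigr => k _.
  by rewrite !mxE eqxx andbT.
have zb k : (z *m A) 0 (b k) = z 0 k * A k (b k).
  rewrite mxE (bigD1 k) //= big1 ?addr0 // => k' k'k.
  by case: (bP k) => _ ->; rewrite ?mulr0.
have gz l : g l 0 * (z *m A) 0 l = y l 0 * (z *m A) 0 l.
  rewrite gE mulrBl mulr_suml big1 ?subr0 // => k _.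
  have [->|lb] := eqVneq l (b k); last by rewrite mulr0 mul0r.
  rewrite mulr1 zb /q; have [->|/zrow[-> _]] := eqVneq (z 0 k) 0.
    by rewrite mul0r mulr0.
  by rewrite !mul0r.
have gends l : (z *m A) 0 l != 0 -> g l 0 = y l 0 by move=> zl; exact: (mulIf zl).
exists g, z; split=> //.
- apply/colP => k; rewrite mulmxBr mulmx_sumr mxE [X in _ + X]mxE summxE.
  rewrite (bigD1 k) //= big1 => [|k' k'k].
    rewrite addr0 -scalemxAr -colE [X in _ - X]mxE [col _ _ _ _]mxE.
    by rewrite /q divfK ?subrr ?mxE //; case: (bP k).
  rewrite -scalemxAr -colE mxE [col _ _ _ _]mxE.
  by case: (bP k') => _ ->; rewrite ?mulr0 // eq_sym.
- move=> l; rewrite gz !inE; case: (eqVneq l i) => [->|li] /=.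
    by rewrite yi mul1r.
  case: (eqVneq l j) => [->|lj]; first by rewrite yj mulf_neq0.
  have [->|yl] := eqVneq (y l 0) 0; first by rewrite mul0r eqxx.
  by rewrite zorth // mulr0 eqxx.
- by rewrite !gends // yi yj divr1.
Qed.

End Search.

(** * Programs with counted loops *)

(** A sublanguage of while-programs in which every loop counts from 0 up to a cell
    of the index array 0.  Its programs terminate, so that they denote functions on
    states ([sem]) and have a running time bounded by a function of the dimensions
    ([tcost]).  In [PFor v x p] the counter is [v] and the bound is cell [x]. *)
Inductive prog :=
  | PISet of nat & iexp & iexp
  | PRSet of nat & iexp & rexp
  | PSeq of prog & prog
  | PIf of bexp & prog
  | PFor of nat & nat & prog.

Definition var v := IGet v (IConst 0).

Definition incr v := ISet v (IConst 0) (IAdd (var v) (IConst 1)).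

Definition guard v x := ILe (IAdd (var v) (IConst 1)) (IGet 0 (IConst x)).

Fixpoint compile (p : prog) : cmd :=
  match p with
  | PISet a i e => ISet a i e
  | PRSet a i e => RSet a i e
  | PSeq p q => Seq (compile p) (compile q)
  | PIf b p => If b (compile p) Skip
  | PFor v x p =>
      Seq (ISet v (IConst 0) (IConst 0)) (While (guard v x) (Seq (compile p) (incr v)))
  end.

Fixpoint imods (p : prog) : seq nat :=
  match p with
  | PISet a _ _ => [:: a]
  | PRSet _ _ _ => [::]
  | PSeq p q => imods p ++ imods q
  | PIf _ p => imods p
  | PFor v _ p => v :: imods p
  end.

Fixpoint rmods (p : prog) : seq nat :=
  match p with
  | PISet _ _ _ => [::]
  | PRSet a _ _ => [:: a]
  | PSeq p q => rmods p ++ rmods q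
  | PIf _ p | PFor _ _ p => rmods p
  end.

(** Neither a loop bound nor the counter of a running loop is overwritten. *)
Fixpoint wf (p : prog) : bool :=
  match p with
  | PISet a _ _ => a != 0%N
  | PRSet _ _ _ => true
  | PSeq p q => wf p && wf q
  | PIf _ p => wf p
  | PFor v _ p => [&& v != 0%N, v \notin imods p & wf p]
  end.

(** Each round of a loop costs 7 for the guard and 6 for the increment; the
    initialization and the last guard cost 3 and 7. *)
Fixpoint tcost (N : nat -> nat) (p : prog) : nat :=
  match p with
  | PISet _ i e => (icost i + icost e).+1
  | PRSet _ i e => (icost i + rcost e).+1
  | PSeq p q => tcost N p + tcost N q
  | PIf b p => bcost b + (tcost N p).+1
  | PFor v x p => N x * (tcost N p + 13) + 10
  end.

Section Programs.
Variable R : realType.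
Implicit Types (s : state R) (p : prog).

Definition iset s a k v := State (update (imem s) a k v) (rmem s).
Definition rset s a k v := State (imem s) (update (rmem s) a k v).

Fixpoint sem p s : state R :=
  match p with
  | PISet a i e => iset s a (ieval s i) (ieval s e)
  | PRSet a i e => rset s a (ieval s i) (reval s e)
  | PSeq p q => sem q (sem p s)
  | PIf b p => if beval s b then sem p s else s
  | PFor v x p =>
      iter (imem s 0 x) (fun s => let s1 := sem p s in iset s1 v 0 (imem s1 v 0 + 1))
        (iset s v 0 0)
  end.

Lemma sem_if b p s : sem (PIf b p) s = if beval s b then sem p s else s.
Proof. by []. Qed.

Lemma sem_seq p q s : sem (PSeq p q) s = sem q (sem p s).
Proof. by []. Qed.

Lemma sem_iset a i e s : sem (PISet a i e) s = iset s a (ieval s i) (ieval s e).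
Proof. by []. Qed.

Lemma sem_rset a i e s : sem (PRSet a i e) s = rset s a (ieval s i) (reval s e).
Proof. by []. Qed.

Lemma rmem_iset s a k v : rmem (iset s a k v) = rmem s.
Proof. by []. Qed.

Lemma rmem_rset s a k v : rmem (rset s a k v) = update (rmem s) a k v.
Proof. by []. Qed.

Lemma update_same T (f : nat -> nat -> T) a k v : update f a k v a k = v.
Proof. by rewrite /update !eqxx. Qed.

Lemma update_array T (f : nat -> nat -> T) a b k v : b != a -> update f a k v b = f b.
Proof. by move=> /negbTE ba; apply/funext => j; rewrite /update ba. Qed.

Lemma update_cell T (f : nat -> nat -> T) a k v l :
  update f a k v a l = if l == k then v else f a l.
Proof. by rewrite /update eqxx. Qed.

Lemma sem_imem p s a : a \notin imods p -> imem (sem p s) a = imem s a.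
Proof.
elim: p s => [b i e|b i e|p IHp q IHq|b p IH|v x p IH] s //=.
- by rewrite inE => ab; exact: update_array.
- by rewrite mem_cat negb_or => /andP[ap aq]; rewrite IHq ?IHp.
- by move=> ap; case: ifP => // _; exact: IH.
- rewrite inE negb_or => /andP[av ap].
  elim: (imem s 0 x) => [|N IHN] /=; first exact: update_array.
  by rewrite update_array // IH.
Qed.

Lemma sem_rmem p s a : a \notin rmods p -> rmem (sem p s) a = rmem s a.
Proof.
elim: p s => [b i e|b i e|p IHp q IHq|b p IH|v x p IH] s //=.
- by rewrite inE => ab; exact: update_array.
- by rewrite mem_cat negb_or => /andP[ap aq]; rewrite IHq ?IHp.
- by move=> ap; case: ifP => // _; exact: IH.
- by move=> ap; elim: (imem s 0 x) => [|N IHN] //=; rewrite IH.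
Qed.

Lemma wf_dims p : wf p -> 0%N \notin imods p.
Proof.
elim: p => [b i e|b i e|p IHp q IHq|b p IH|v x p IH] //=.
- by rewrite inE eq_sym.
- by rewrite mem_cat negb_or => /andP[/IHp -> /IHq ->].
- by case/and3P=> v0 _ /IH p0; rewrite inE negb_or eq_sym v0.
Qed.

Lemma sem_dims p s : wf p -> imem (sem p s) 0 = imem s 0.
Proof. by move/wf_dims; exact: sem_imem. Qed.

(** The running time and the effect of a program are thereby separated from its
    execution relation. *)
Lemma exec_compile p s : wf p ->
  exists2 t, exec (compile p) s t (sem p s) & (t <= tcost (imem s 0) p)%N.
Proof.
elim: p s => [a i e|a i e|p IHp q IHq|b p IH|v x p IH] s /=.
- by move=> _; exists (icost i + icost e).+1 => //; exact: exec_iset.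
- by move=> _; exists (icost i + rcost e).+1 => //; exact: exec_rset.
- case/andP=> wp wq; have [t1 e1 t1le] := IHp s wp.
  have [t2 e2 t2le] := IHq (sem p s) wq.
  exists (t1 + t2)%N; first exact: exec_seq e1 e2.
  by rewrite leq_add // -(sem_dims s wp).
- move=> /(IH s) [t et tle].
  case bs : (beval s b).
    exists (bcost b + t)%N; last by rewrite leq_add // ltnW.
    by apply: exec_if; rewrite bs.
  exists (bcost b + 1)%N; last by rewrite leq_add.
  by apply: exec_if; rewrite bs; exact: exec_skip.
case/and3P=> v0 vp wp.
set step := fun s => _.
have loop N s1 k : (k + N = imem s 0 x)%N -> imem s1 v 0 = k -> imem s1 0 = imem s 0 ->
  exists2 t, exec (While (guard v x) (Seq (compile p) (incr v))) s1 t (iter N step s1)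
    & (t <= N * (tcost (imem s 0) p + 13) + 7)%N.
  elim: N s1 k => [|N IHN] s1 k kN s1v s10.
    exists 7 => //.
    apply: (@exec_while_false _ (guard v x)).
    by rewrite /= s1v s10 -kN addn0 addn1 ltnn.
  have [t1 e1 t1le] := IH s1 wp.
  rewrite s10 in t1le.
  have stepv : imem (step s1) v 0 = k.+1.
    by rewrite /= update_same sem_imem // s1v addn1.
  have step0 : imem (step s1) 0 = imem s 0.
    by rewrite /= update_array 1?eq_sym // sem_dims.
  have [|t2 e2 t2le] := IHN (step s1) k.+1 _ stepv step0; first by rewrite addSnnS.
  rewrite iterSr; exists (bcost (guard v x) + (t1 + 6) + t2)%N.
    apply: exec_while_true e2; first by rewrite /= s1v s10 -kN addn1 addnS ltnS leq_addr.
    apply: exec_seq e1 _; exact: exec_iset.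
  rewrite /= mulSn; lia.
have [||t et tle] := loop (imem s 0 x) (iset s v 0 0) 0%N (add0n _).
- by rewrite /= update_same.
- by rewrite /= update_array // eq_sym.
exists (3 + t)%N; last by lia.
by apply: exec_seq et; exact: exec_iset.
Qed.

(** The invariant rule for loops.  The arrays that the body does not modify keep
    their initial contents in every round, so that invariants need not mention
    them. *)
Lemma sem_for P s (J : nat -> state R -> Prop) v x p : P = PFor v x p -> wf P ->
  J 0%N (iset s v 0 0) ->
  (forall k s1, (k < imem s 0 x)%N -> imem s1 v 0 = k ->
     (forall a, a \notin v :: imods p -> imem s1 a = imem s a) ->
     (forall a, a \notin rmods p -> rmem s1 a = rmem s a) ->
     J k s1 -> J k.+1 (iset (sem p s1) v 0 k.+1)) ->
  J (imem s 0 x) (sem P s).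
Proof.
move=> -> /= /and3P[v0 vp wp] J0 JS.
set step := fun s => _.
suff loop N : (N <= imem s 0 x)%N -> let sN := iter N step (iset s v 0 0) in
    [/\ imem sN v 0 = N,
     forall a, a \notin v :: imods p -> imem sN a = imem s a,
     forall a, a \notin rmods p -> rmem sN a = rmem s a & J N sN].
  by have [] := loop (imem s 0 x) (leqnn _).
elim: N => [_|N IHN NN] /=.
  split=> //; first by rewrite update_same.
  by move=> a; rewrite inE negb_or => /andP[av _]; exact: update_array.
have [sv si sr sJ] := IHN (ltnW NN).
have Nv : (imem (sem p (iter N step (iset s v 0 0))) v 0 + 1)%N = N.+1.
  by rewrite sem_imem // sv addn1.
split.
- by rewrite update_same Nv.
- move=> a /[dup] av; rewrite inE negb_or => /andP[anv ap].
  by rewrite update_array // sem_imem // si.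
- by move=> a ap; rewrite sem_rmem // sr.
- by have := JS N _ NN sv si sr sJ; rewrite -[X in iset _ _ _ X]Nv.
Qed.

End Programs.

Arguments sem : simpl never.

(** * Gauss-Jordan elimination *)

(** Names of the arrays of the program: index arrays first, then real arrays.
    The arrays [mat], [est] and [dg] are those of the input and of the output. *)
Local Notation kvar := 1%N (only parsing).
Local Notation pvar := 2%N (only parsing).
Local Notation rvar := 3%N (only parsing).
Local Notation cvar := 4%N (only parsing).
Local Notation srcvar := 5%N (only parsing).
Local Notation rndvar := 6%N (only parsing).
Local Notation mat := 0%N (only parsing).
Local Notation est := 1%N (only parsing).
Local Notation dg := 2%N (only parsing).
Local Notation clab := 3%N (only parsing).
Local Notation rlab := 4%N (only parsing).
Local Notation fac := 5%N (only parsing).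

Definition dimn := IGet 0 (IConst 1).
Definition entry i j := RGet mat (IAdd (IMul i dimn) j).
Definition nonzero e := BNot (BAnd (RLe e (RConst 0)) (RLe (RConst 0) e)).
Definition magnitude e := RSqrt (RMul e e).

(** The last non-zero entry of the row is taken, as the loop always runs to the
    end. *)
Definition find_pivot :=
  PFor cvar 1 (PIf (nonzero (entry (var kvar) (var cvar)))
    (PISet pvar (IConst 0) (var cvar))).

Definition subtract_row :=
  PFor cvar 1 (PRSet mat (IAdd (IMul (var rvar) dimn) (var cvar))
    (RSub (entry (var rvar) (var cvar))
       (RMul (RGet fac (IConst 0)) (entry (var kvar) (var cvar))))).

Definition eliminate :=
  PFor rvar 0
    (PIf (BNot (BAnd (ILe (var rvar) (var kvar)) (ILe (var kvar) (var rvar))))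
      (PSeq (PRSet fac (IConst 0)
               (RDiv (entry (var rvar) (var pvar)) (entry (var kvar) (var pvar))))
         subtract_row)).

Definition gauss_jordan := PFor kvar 0 (PSeq find_pivot eliminate).

Section Elimination.
Variable R : realType.
Implicit Type s : state R.

Definition cell s r c : R := rmem s mat (r * imem s 0 1 + c).

Lemma beval_nonzero s e : beval s (nonzero e) = (reval s e != 0).
Proof. by rewrite /= -eq_le. Qed.

Lemma find_pivotP s (k := imem s kvar 0) (p := imem (sem find_pivot s) pvar 0) :
  (exists2 c, (c < imem s 0 1)%N & cell s k c != 0) ->
  (p < imem s 0 1)%N /\ cell s k p != 0.
Proof.
case=> c cn kc.
have [] := sem_for (P := find_pivot) (s := s) (J := fun q s1 =>
  (forall c, (c < q)%N -> cell s k c = 0) \/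
  (imem s1 pvar 0 < imem s 0 1)%N /\ cell s k (imem s1 pvar 0) != 0) erefl isT _ _.
- by left.
- move=> q s1 qn s1c fi fr J.
  have kE : reval s1 (entry (var kvar) (var cvar)) = cell s k q.
    by rewrite /= s1c fr // !fi //.
  rewrite sem_if sem_iset beval_nonzero kE; case: eqP => [kq|/eqP kq] /=.
    case: J => [J|J]; [left=> d | by right].
    by rewrite ltnS leq_eqVlt => /predU1P[->|/J].
  by right; rewrite /update /= s1c.
- by move=> /(_ c cn) kc0; rewrite kc0 eqxx in kc.
- by [].
Qed.

Lemma cell_index_inj n r c r' c' : (c < n)%N -> (c' < n)%N ->
  (r' * n + c' == r * n + c)%N = (r' == r) && (c' == c).
Proof.
move=> cn c'n; apply/eqP/andP => [e|[/eqP-> /eqP->]//].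
have n0 : (0 < n)%N by exact: leq_ltn_trans cn.
have := congr1 (modn^~ n) e; have := congr1 (divn^~ n) e.
by rewrite !modnMDl !divnMDl // !modn_small // !divn_small // !addn0 => -> ->.
Qed.

Lemma subtract_rowP s (r := imem s rvar 0) (k := imem s kvar 0) r' c' : r != k ->
  (c' < imem s 0 1)%N ->
  rmem (sem subtract_row s) mat (r' * imem s 0 1 + c') =
    if r' == r then cell s r c' - rmem s fac 0 * cell s k c' else cell s r' c'.
Proof.
move=> rk c'n; pose n := imem s 0 1.
pose J q s1 := forall r' c', (c' < n)%N ->
  rmem s1 mat (r' * n + c') = if (r' == r) && (c' < q)%N then
    cell s r c' - rmem s fac 0 * cell s k c' else cell s r' c'.
have JN : J n (sem subtract_row s); last first.
  by rewrite JN // c'n andbT.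
apply: (sem_for (J := J) erefl) => // [a b bn|q s1 qn s1c fi fr Jq a b bn /=].
  by rewrite andbF.
rewrite s1c !fi // (fr fac) // update_cell -/n -/r -/k cell_index_inj //.
case: eqP => [->|ar] /=; last by rewrite Jq //; case: eqP.
case: eqP => [->|bq].
  by rewrite ltnS leqnn !Jq // eqxx ltnn eq_sym (negbTE rk).
by rewrite Jq // eqxx ltnS (leq_eqVlt b); case: eqP.
Qed.

Lemma eliminateP s (k := imem s kvar 0) (p := imem s pvar 0) r c :
  (p < imem s 0 1)%N -> (c < imem s 0 1)%N -> (r < imem s 0 0)%N ->
  rmem (sem eliminate s) mat (r * imem s 0 1 + c) =
    if r == k then cell s k c else cell s r c - cell s r p / cell s k p * cell s k c.
Proof.
move=> pn cn rm; pose n := imem s 0 1.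
pose J q s1 := forall r c, (c < n)%N ->
  rmem s1 mat (r * n + c) = if (r < q)%N && (r != k) then
    cell s r c - cell s r p / cell s k p * cell s k c else cell s r c.
have JN : J (imem s 0 0) (sem eliminate s); last first.
  by rewrite JN // rm /=; case: eqP => // ->.
apply: (sem_for (J := J) erefl) => // q s1 qm s1r fi fr Jq a b bn.
have -> : sem (PIf (BNot (BAnd (ILe (var rvar) (var kvar)) (ILe (var kvar) (var rvar))))
      (PSeq (PRSet fac (IConst 0)
               (RDiv (entry (var rvar) (var pvar)) (entry (var kvar) (var pvar))))
         subtract_row)) s1 =
   if q != k then sem subtract_row (rset s1 fac 0 (cell s q p / cell s k p)) else s1.
  rewrite sem_if sem_seq sem_rset [beval _ _]/= [reval _ _]/= [ieval _ _]/=.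
  rewrite s1r !fi // -eqn_leq -/k -/p; case: eqP => // qk.
  by rewrite !Jq // ltnn eqxx andbF.
case: eqP => [qk|/eqP qk].
  rewrite /= Jq // ltnS (leq_eqVlt a); case: (eqVneq a q) => [->|//].
  by rewrite qk eqxx !andbF.
have := @subtract_rowP (rset s1 fac 0 (cell s q p / cell s k p)) a b.
rewrite /cell /= s1r !fi // => -> //.
rewrite update_same !(@update_array _ _ fac mat) // -/n -/k !Jq // ltnn /= eqxx andbF.
case: (eqVneq a q) => [->|aq]; first by rewrite ltnS leqnn qk.
by rewrite ltnS (leq_eqVlt a) (negbTE aq).
Qed.

Definition stored m n s : 'M[R]_(m, n) := \matrix_(r, c) rmem s mat (r * n + c).

(** Adding multiples of row [k] to the other rows does not change the kernel,
    which is all that the condition number depends on. *)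
Lemma kerset_row_sub m n (A B : 'M[R]_(m, n)) k (f : 'I_m -> R) :
  (forall r c, B r c = if r == k then A k c else A r c - f r * A k c) ->
  kerset B = kerset A.
Proof.
move=> BE.
have rowE x r : (B *m x) r 0 =
    if r == k then (A *m x) k 0 else (A *m x) r 0 - f r * (A *m x) k 0.
  rewrite !mxE; case: eqVneq => [->|rk].
    by apply: eq_bigr => c _; rewrite BE eqxx.
  rewrite mulr_sumr -sumrB; apply: eq_bigr => c _.
  by rewrite BE (negbTE rk); ring.
apply/seteqP; split=> x; rewrite /kerset /= => /colP Ax.
  have Akx : (A *m x) k 0 = 0 by have := Ax k; rewrite rowE eqxx => ->; rewrite mxE.
  apply/colP => r; have := Ax r; rewrite rowE Akx mulr0 subr0 => Bx.
  by move: Bx; case: eqP => [->|_ ->//]; rewrite Akx => _; rewrite mxE.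
have Ax0 r : (A *m x) r 0 = 0 by rewrite (Ax r) mxE.
by apply/colP => r; rewrite rowE !Ax0 mulr0 subr0 if_same mxE.
Qed.

Lemma row_free_kerset m n (A B : 'M[R]_(m, n)) :
  row_free A -> kerset B = kerset A -> row_free B.
Proof.
move=> /eqP Af kE; rewrite /row_free eqn_leq rank_leq_row -{1}Af.
by apply/mxrankS/kerset_submx; rewrite kE.
Qed.

(** The matrix stays of full row rank because its kernel is unchanged; hence the
    row being processed has a pivot.  Earlier pivot columns vanish in that row and
    are not disturbed. *)
Lemma gauss_jordanP m n s (A : 'M[R]_(m, n)) (B := stored m n (sem gauss_jordan s)) :
  imem s 0 0 = m -> imem s 0 1 = n -> row_free A -> kerset (stored m n s) = kerset A ->
  kerset B = kerset A /\ has_basis B.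
Proof.
move=> sm sn Af kA.
pose J q s1 := let M := stored m n s1 in kerset M = kerset A /\
  forall k : 'I_m, (k < q)%N ->
    exists c, M k c != 0 /\ forall k', k' != k -> M k' c = 0.
have [kB basisB] : J m (sem gauss_jordan s); last first.
  by split=> // k; apply: basisB.
rewrite -{1}sm; apply: (sem_for (J := J) erefl) => // q s1; rewrite sm => qm s1k fi _ [kM bM].
pose k := Ordinal qm; set M := stored m n s1 in kM bM.
have s1n : imem s1 0 1 = n by rewrite fi.
have s1m : imem s1 0 0 = m by rewrite fi.
have cellE (r : 'I_m) (c : 'I_n) : cell s1 r c = M r c by rewrite mxE /cell s1n.
have [] := @find_pivotP s1.
  have /existsP[c Mkc] : [exists c, M k c != 0].
    have Mf : row_free M by exact: row_free_kerset Af kM.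
    apply: contraT => /existsPn M0.
    have : (delta_mx 0 k : 'rV[R]_m) *m M = 0.
      by apply/rowP => c; rewrite -rowE !mxE; apply/eqP/negPn; move: (M0 c); rewrite mxE.
    move/eqP; rewrite (mulmx_free_eq0 _ Mf) => /eqP/rowP/(_ k)/eqP.
    by rewrite !mxE !eqxx oner_eq0.
  by exists c; rewrite ?s1n // s1k; rewrite -cellE in Mkc.
rewrite s1n s1k; set s2 := sem find_pivot s1 => pn.
pose p := Ordinal pn; rewrite -[q]/(k : nat) -[imem s2 pvar 0]/(p : nat) cellE => Mkp.
have s2E a : a \notin [:: cvar; pvar] -> imem s2 a = imem s1 a
  by exact: (@sem_imem _ find_pivot).
have s2r : rmem s2 = rmem s1 by apply/funext => a; exact: (@sem_rmem _ find_pivot).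
pose M' := stored m n (iset (sem (PSeq find_pivot eliminate) s1) kvar 0 q.+1).
have M'E r c : M' r c = if r == k then M k c else M r c - M r p / M k p * M k c.
  rewrite mxE [rmem _]/= sem_seq -/s2.
  have := @eliminateP s2 r c; rewrite /cell !(s2E 0%N) // !(s2E kvar) // s2r s1n s1m s1k => -> //.
  by rewrite !mxE.
split; first by rewrite -kM; exact: (@kerset_row_sub _ _ _ _ k (fun r => M r p / M k p)).
move=> l; rewrite ltnS leq_eqVlt => /predU1P[lq|/[dup] lq /bM[c [Mlc Mc]]].
  have -> : l = k by apply: val_inj.
  exists p; rewrite -/M' M'E eqxx; split=> // k' k'k.
  by rewrite M'E (negbTE k'k) divfK // subrr.
have lk : l != k by rewrite neq_ltn lq.
have Mkc : M k c = 0 by apply: Mc; rewrite eq_sym.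
exists c; rewrite -/M' M'E (negbTE lk) Mkc mulr0 subr0; split=> // k' k'l.
by rewrite M'E Mkc mulr0 subr0; case: eqP => // _; exact: Mc.
Qed.

End Elimination.

(** * Labelling the columns reachable from a source *)

(** Rows and columns are labelled by the same program with the two counters
    exchanged: [v] runs over the labels being written, [w] over those being read. *)
Definition label_one v w xw dst src val :=
  PFor w xw (PIf (BAnd (nonzero (RGet src (var w))) (nonzero (entry (var rvar) (var cvar))))
    (PRSet dst (var v) val)).

Definition label_all v xv w xw dst src val :=
  PFor v xv (PIf (BNot (nonzero (RGet dst (var v)))) (label_one v w xw dst src val)).

Definition row_pass := label_all rvar 0 cvar 1 rlab clab
  (RMul (RGet clab (var cvar)) (entry (var rvar) (var cvar))).

Definition col_pass := label_all cvar 1 rvar 0 clab rlab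
  (RSub (RConst 0) (RDiv (RGet rlab (var rvar)) (entry (var rvar) (var cvar)))).

Definition clear v x a := PFor v x (PRSet a (var v) (RConst 0)).

Definition search :=
  PSeq (clear cvar 1 clab)
 (PSeq (PRSet clab (var srcvar) (RConst 1))
 (PSeq (clear rvar 0 rlab)
       (PFor rndvar 0 (PSeq row_pass col_pass)))).

Definition record_labels :=
  PFor cvar 1 (PIf (nonzero (RGet clab (var cvar)))
    (PSeq (PRSet dg (var cvar) (RDiv (RConst 1) (magnitude (RGet clab (var cvar)))))
      (PIf (RLe (RGet est (IConst 0)) (magnitude (RGet clab (var cvar))))
        (PRSet est (IConst 0) (magnitude (RGet clab (var cvar))))))).

Definition all_sources := PFor srcvar 1 (PSeq search record_labels).

Definition algorithm :=
  PSeq gauss_jordan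
 (PSeq (PRSet est (IConst 0) (RConst 1))
 (PSeq all_sources
       (PIf (ILe (IGet 0 (IConst 0)) (IConst 0)) (PRSet est (IConst 0) (RConst 0))))).

Section Labels.
Variable R : realType.
Implicit Type s : state R.

Section Pass.
Variables (v xv w xw dst src : nat) (val : rexp).
Variables (E : (nat -> R) -> nat -> nat -> nat -> R) (f : R -> R -> R).
Hypotheses (v0 : v != 0%N) (w0 : w != 0%N) (vw : v != w).
Hypotheses (dst0 : dst != mat) (dstsrc : dst != src).
(** The function [E] reads an entry of the stored matrix from the contents of the
    array, the row length and the counters [v] and [w], in this order. *)
Hypothesis entryE : forall s, reval s (entry (var rvar) (var cvar)) =
  E (rmem s mat) (imem s 0 1) (imem s v 0) (imem s w 0).
Hypothesis valE : forall s, reval s val =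
  f (rmem s src (imem s w 0)) (reval s (entry (var rvar) (var cvar))).

Definition labelled s N x (a : R) :=
  (a = 0 /\ forall y, (y < N)%N -> rmem s src y != 0 -> E (rmem s mat) (imem s 0 1) x y = 0)
  \/ exists y, [/\ (y < N)%N, rmem s src y != 0, E (rmem s mat) (imem s 0 1) x y != 0
     & a = f (rmem s src y) (E (rmem s mat) (imem s 0 1) x y)].

Lemma label_oneP s (x := imem s v 0) (s' := sem (label_one v w xw dst src val) s) :
  rmem s dst x = 0 ->
  labelled s (imem s 0 xw) x (rmem s' dst x) /\
  forall x', x' != x -> rmem s' dst x' = rmem s dst x'.
Proof.
move=> dx0; pose J q s1 := labelled s q x (rmem s1 dst x) /\
  forall x', x' != x -> rmem s1 dst x' = rmem s dst x'.
apply: (sem_for (J := J) erefl); first by rewrite /= w0.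
  by split=> //; left.
move=> q s1 qN s1w fi fr [Jx Jn].
have s1v : imem s1 v 0 = x by rewrite fi //= inE.
have s10 : imem s1 0 = imem s 0 by rewrite fi //= inE eq_sym.
have s1src : rmem s1 src = rmem s src by rewrite fr //= inE eq_sym.
have s1mat : rmem s1 mat = rmem s mat by rewrite fr //= inE eq_sym.
have eE : reval s1 (entry (var rvar) (var cvar)) = E (rmem s mat) (imem s 0 1) x q.
  by rewrite entryE s1mat s10 s1v s1w.
rewrite sem_if sem_rset.
have -> : beval s1 (BAnd (nonzero (RGet src (var w))) (nonzero (entry (var rvar) (var cvar))))
  = (rmem s src q != 0) && (E (rmem s mat) (imem s 0 1) x q != 0).
  rewrite -[LHS]/(beval s1 (nonzero (RGet src (var w))) &&
    beval s1 (nonzero (entry (var rvar) (var cvar)))) !beval_nonzero eE.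
  by rewrite [reval _ (RGet _ _)]/= s1w s1src.
case: ifP => [/andP[sq Eq]|sEq] /=.
  split=> [|x' x'x].
    rewrite rmem_iset rmem_rset s1v update_same; right; exists q; split=> //.
    by rewrite valE eE s1src s1w.
  by rewrite rmem_iset rmem_rset s1v update_cell (negbTE x'x) Jn.
split=> //=; case: Jx => [[a0 Jq]|[y [yq sy Ey ->]]]; last first.
  by right; exists y; split=> //; exact: ltnW.
left; split=> // y; rewrite ltnS leq_eqVlt => /predU1P[->|/Jq//].
by move=> sq; move: sEq; rewrite sq => /negbFE/eqP.
Qed.

Lemma label_allP s (s' := sem (label_all v xv w xw dst src val) s) x :
  (x < imem s 0 xv)%N ->
  if rmem s dst x != 0 then rmem s' dst x = rmem s dst x
  else labelled s (imem s 0 xw) x (rmem s' dst x).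
Proof.
pose J q s1 := forall x, if (x < q)%N && (rmem s dst x == 0)
  then labelled s (imem s 0 xw) x (rmem s1 dst x) else rmem s1 dst x = rmem s dst x.
have JN : J (imem s 0 xv) s'; last first.
  by move=> xN; have := JN x; rewrite xN /=; case: eqP.
apply: (sem_for (J := J) erefl) => //=; first by rewrite v0 inE vw w0.
move=> q s1 qN s1v fi fr Jq y.
have s10 : imem s1 0 = imem s 0 by rewrite fi // !inE negb_or eq_sym v0 eq_sym w0.
have s1src : rmem s1 src = rmem s src by rewrite fr //= inE eq_sym.
have s1mat : rmem s1 mat = rmem s mat by rewrite fr //= inE eq_sym.
have dq : rmem s1 dst q = rmem s dst q by have := Jq q; rewrite ltnn.
rewrite sem_if -[beval _ _]/(~~ beval s1 (nonzero (RGet dst (var v)))) beval_nonzero negbK.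
rewrite [reval _ _]/= s1v dq.
have [d0|d0] := eqVneq (rmem s dst q) 0; last first.
  rewrite /= ltnS leq_eqVlt; have [->|yq] := eqVneq y q; last exact: Jq.
  by rewrite (negbTE d0).
have [] := @label_oneP s1; first by rewrite s1v dq.
rewrite s1v s10 => lab keep; rewrite [rmem _]/= ltnS leq_eqVlt.
have [->|yq] := eqVneq y q.
  by move: lab; rewrite d0 eqxx /labelled s1src s1mat s10.
by rewrite keep //; exact: Jq.
Qed.

End Pass.

Definition col_labels n s (c : 'I_n) : R := rmem s clab c.
Definition row_labels m s (r : 'I_m) : R := rmem s rlab r.

Lemma row_passP m n s : imem s 0 0 = m -> imem s 0 1 = n ->
  row_step (stored m n s) (@col_labels n s) (@row_labels m s)
    (@row_labels m (sem row_pass s)).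
Proof.
move=> sm sn r.
have := @label_allP rvar 0 cvar 1 rlab clab
  (RMul (RGet clab (var cvar)) (entry (var rvar) (var cvar))) (fun M n r c => M (r * n + c)%N) *%R
  isT isT isT isT isT (fun=> erefl) (fun=> erefl) s r.
rewrite sm ltn_ord => /(_ isT); rewrite /row_labels -/row_pass; case: ifP => // _.
rewrite /labelled sn; case=> [[-> E0]|[y [yn sy Ey ->]]]; [left|right].
  by split=> // c sc; rewrite mxE E0.
by exists (Ordinal yn); rewrite mxE.
Qed.

Lemma col_passP m n s : imem s 0 0 = m -> imem s 0 1 = n ->
  col_step (stored m n s) (@row_labels m s) (@col_labels n s)
    (@col_labels n (sem col_pass s)).
Proof.
move=> sm sn c.
have := @label_allP cvar 1 rvar 0 clab rlab
  (RSub (RConst 0) (RDiv (RGet rlab (var rvar)) (entry (var rvar) (var cvar))))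
  (fun M n c r => M (r * n + c)%N)
  (fun a b => - (a / b)) isT isT isT isT isT (fun=> erefl) (fun=> sub0r _) s c.
rewrite sn ltn_ord => /(_ isT); rewrite /col_labels -/col_pass; case: ifP => // _.
rewrite /labelled sm sn; case=> [[-> E0]|[y [yn sy Ey ->]]]; [left|right].
  by split=> // r sr; rewrite mxE E0.
by exists (Ordinal yn); rewrite mxE.
Qed.

Lemma clearP v x a s y : v != 0%N -> (y < imem s 0 x)%N ->
  rmem (sem (clear v x a) s) a y = 0.
Proof.
move=> v0; pose J q s1 := forall y, (y < q)%N -> rmem s1 a y = 0 :> R.
suff JN : J (imem s 0 x) (sem (clear v x a) s) by exact: JN.
apply: (sem_for (J := J) erefl) => //=; first by rewrite v0.
move=> q s1 qN s1v fi fr Jq z zq.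
rewrite sem_rset rmem_iset rmem_rset [ieval _ _]/= s1v update_cell.
by case: eqP => // /eqP zneq; apply: Jq; rewrite ltn_neqAle zneq.
Qed.

Lemma searchP m n s (i : 'I_n) (M := stored m n s) (s' := sem search s) :
  imem s 0 0 = m -> imem s 0 1 = n -> imem s srcvar 0 = i ->
  search_inv M i (@col_labels n s') (@row_labels m s') /\
  closed_labels M (@col_labels n s') (@row_labels m s').
Proof.
move=> sm sn si; rewrite /s' /search !sem_seq.
set s1 := sem (clear cvar 1 clab) s; set s2 := sem (PRSet clab _ _) s1.
set s3 := sem (clear rvar 0 rlab) s2; set rounds := PFor rndvar 0 _.
have [s3m s3n] : imem s3 0 0 = m /\ imem s3 0 1 = n.
  by rewrite /s3 sem_dims //= /s1 sem_dims.
have s3M : stored m n s3 = M.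
  apply/matrixP => r c; rewrite !mxE /s3 sem_rmem // /s2 sem_rset rmem_rset.
  by rewrite update_array // sem_rmem.
have s3c c : @col_labels n s3 c = (c == i)%:R.
  rewrite /col_labels /s3 sem_rmem // /s2 sem_rset rmem_rset update_cell.
  rewrite [ieval _ _]/= /s1 sem_imem // si; case: (eqVneq c i) => [->|ci].
    by rewrite eqxx.
  by rewrite val_eqE (negbTE ci) clearP // sn.
have s3r r : @row_labels m s3 r = 0.
  by rewrite /row_labels /s3 clearP // /s2 sem_rset /= /s1 sem_dims // sm.
pose J q s4 := search_inv M i (@col_labels n s4) (@row_labels m s4) /\
  (closed_labels M (@col_labels n s4) (@row_labels m s4) \/
   (q <= #|marked (@row_labels m s4)|)%N).
have [inv cl] : J m (sem rounds s3); last first.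
  by split=> //; exact: all_rows_closed inv cl.
rewrite -{1}s3m; apply: (sem_for (J := J) erefl) => //.
  split; last by right.
  have -> : @col_labels n (iset s3 rndvar 0 0) = fun c => (c == i)%:R.
    by apply/funext => c; exact: s3c.
  have -> : @row_labels m (iset s3 rndvar 0 0) = fun=> 0 by apply/funext => c; exact: s3r.
  exact: search_inv_init.
move=> q s4 qm s4q fi fr [inv cl]; rewrite sem_seq.
set s5 := sem row_pass s4; set s6 := sem col_pass s5.
have s4m : imem s4 0 0 = m by rewrite fi.
have s4n : imem s4 0 1 = n by rewrite fi.
have s4M : stored m n s4 = M by rewrite -s3M; apply/matrixP => r c; rewrite !mxE fr.
have s5M : stored m n s5 = M.
  by rewrite -s4M; apply/matrixP => r c; rewrite !mxE /s5 sem_rmem.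
have := row_passP s4m s4n; rewrite s4M -/s5 => rs.
have := @col_passP m n s5; rewrite /s5 sem_dims // -/s5 s5M => /(_ s4m s4n).
rewrite -/s6 => cs.
have s5c : @col_labels n s5 = @col_labels n s4.
  by apply/funext => c; rewrite /col_labels /s5 sem_rmem.
have s6r : @row_labels m s6 = @row_labels m s5.
  by apply/funext => c; rewrite /row_labels /s6 sem_rmem.
rewrite s5c in cs; split.
- have := search_inv_step inv rs cs; by rewrite -s6r.
- have := closed_labels_step inv rs cs cl; by rewrite -s6r.
Qed.

Lemma recordP s (n := imem s 0 1) (s' := sem record_labels s) :
  [/\ forall j, (j < n)%N -> rmem s' dg j =
        if rmem s clab j != 0 then `|rmem s clab j|^-1 else rmem s dg j,
      rmem s est 0 <= rmem s' est 0,
      forall j, (j < n)%N -> rmem s clab j != 0 -> `|rmem s clab j| <= rmem s' est 0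
    & rmem s' est 0 = rmem s est 0 \/ exists j,
        [/\ (j < n)%N, rmem s clab j != 0 & rmem s' est 0 = `|rmem s clab j|]].
Proof.
pose J q s1 := [/\ forall j, rmem s1 dg j =
    if (j < q)%N && (rmem s clab j != 0) then `|rmem s clab j|^-1 else rmem s dg j,
  rmem s est 0 <= rmem s1 est 0,
  forall j, (j < q)%N -> rmem s clab j != 0 -> `|rmem s clab j| <= rmem s1 est 0
  & rmem s1 est 0 = rmem s est 0 \/ exists j,
    [/\ (j < n)%N, rmem s clab j != 0 & rmem s1 est 0 = `|rmem s clab j|]].
have [Jd Jx Jle Jeq] : J n s'; last first.
  by split=> // j jn; rewrite Jd jn.
apply: (sem_for (J := J) erefl) => //; first by split=> //; left.
move=> q s1 qn s1q fi fr [Jd Jx Jle Jeq].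
have magE s2 : rmem s2 clab = rmem s clab -> imem s2 cvar 0 = q ->
    reval s2 (magnitude (RGet clab (var cvar))) = `|rmem s clab q|.
  by move=> /= -> ->; rewrite -expr2 sqrtr_sqr.
have s1c : rmem s1 clab = rmem s clab by rewrite fr.
rewrite sem_if beval_nonzero [reval _ _]/= s1q s1c.
have [cq|cq] := eqVneq (rmem s clab q) 0.
  split=> //= j; last first.
    by rewrite ltnS leq_eqVlt => /predU1P[->|/Jle//]; rewrite cq eqxx.
  rewrite Jd ltnS (leq_eqVlt j); case: (eqVneq j q) => //= ->.
  by rewrite cq eqxx andbF.
rewrite [~~ _]/= sem_seq sem_rset.
set s2 := rset s1 dg _ _.
have s2d j : rmem s2 dg j = if (j < q.+1)%N && (rmem s clab j != 0)
    then `|rmem s clab j|^-1 else rmem s dg j.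
  rewrite /s2 rmem_rset update_cell [ieval _ _]/= s1q ltnS (leq_eqVlt j).
  case: (eqVneq j q) => [->|jq]; last by rewrite Jd.
  by rewrite cq -[LHS]/(1%:R / reval s1 (magnitude (RGet clab (var cvar)))) magE // div1r.
have s2x : rmem s2 est = rmem s1 est by rewrite /s2 rmem_rset update_array.
rewrite sem_if sem_rset -[beval _ _]/(rmem s2 est 0 <= reval s2 (magnitude (RGet clab (var cvar)))).
rewrite magE // s2x; case: ifP => [xle|/negbT]; last first.
  rewrite -ltNge => xlt; split; rewrite ?rmem_iset ?s2x //.
  move=> j; rewrite ltnS leq_eqVlt => /predU1P[-> _|/Jle//]; exact: ltW.
split; rewrite ?rmem_iset rmem_rset ?update_same //.
- exact: le_trans xle.
- move=> j; rewrite ltnS leq_eqVlt => /predU1P[-> _//|/Jle H cj].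
  exact: le_trans (H cj) xle.
- by right; exists q.
Qed.

End Labels.

(** * The algorithm *)

Section Algorithm.
Variable R : realType.
Implicit Type s : state R.

Definition scale_row n s : 'rV[R]_n := \row_(j < n) rmem s dg j.

(** The scaling is overwritten at every source that reaches the index.  The last
    such source serves as the root [r] of the component: linked indices are
    reached by the same sources, so that they have the same root. *)
Lemma all_sourcesP m n s (M := stored m n s) (s' := sem all_sources s) :
  imem s 0 0 = m -> imem s 0 1 = n -> (0 < n)%N -> row_free M -> has_basis M ->
  rmem s est 0 = 1 ->
  [/\ exists i j, ratio_witness M i j (rmem s' est 0),
      forall i j, linked M i j ->
        exists2 w, ratio_witness M i j w & w <= rmem s' est 0
    & forall i j, linked M i j -> exists r,
        ratio_witness M r i (scale_row n s' 0 i)^-1 /\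
        ratio_witness M r j (scale_row n s' 0 j)^-1].
Proof.
move=> sm sn n0 Mf Mb xi1.
pose J q s1 := [/\ exists i j, ratio_witness M i j (rmem s1 est 0),
  forall i j : 'I_n, (i < q)%N -> linked M i j ->
    exists2 w, ratio_witness M i j w & w <= rmem s1 est 0
  & forall i j : 'I_n, linked M i j -> (exists r,
      ratio_witness M r i (scale_row n s1 0 i)^-1 /\
      ratio_witness M r j (scale_row n s1 0 j)^-1) \/ (q <= i /\ q <= j)%N].
have [Jx Jl Jd] : J n s'; last first.
  split=> // [i j|i j ij]; first exact: Jl.
  by case: (Jd i j ij) => // -[]; rewrite leqNgt ltn_ord.
rewrite -{1}sn; apply: (sem_for (J := J) erefl) => //.
  split=> //; last by right.
  by exists (Ordinal n0), (Ordinal n0); left.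
move=> q s1; rewrite sn => qn s1q fi fr [Jx Jl Jd]; pose k := Ordinal qn.
rewrite sem_seq; set s2 := sem search s1.
have s1m : imem s1 0 0 = m by rewrite fi.
have s1n : imem s1 0 1 = n by rewrite fi.
have s1M : stored m n s1 = M by apply/matrixP => r c; rewrite !mxE fr.
have [] := @searchP _ m n s1 k s1m s1n s1q; rewrite s1M -/s2.
set cl := col_labels s2; set rl := row_labels s2 => inv clo.
have wit j : cl j != 0 -> ratio_witness M k j `|cl j| by exact: search_witness Mb inv.
have same a b : linked M a b -> (cl a != 0) = (cl b != 0) by exact: closed_linked Mf clo _ _.
have clk : cl k != 0 by case: inv => -> _ _; exact: oner_neq0.
have s2x : rmem s2 est = rmem s1 est by rewrite /s2 sem_rmem.
have s2d : rmem s2 dg = rmem s1 dg by rewrite /s2 sem_rmem.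
have s2n : imem s2 0 1 = n by rewrite /s2 sem_dims.
have := recordP s2; set s3 := sem record_labels s2; rewrite s2n => -[Rd Rx Rle Req].
have dE j : scale_row n s3 0 j = if cl j != 0 then `|cl j|^-1 else scale_row n s1 0 j.
  by rewrite !mxE Rd // s2d.
have J3 : J q.+1 s3; last by [].
split.
- case: Req => [->|[j [jn cj ->]]]; first by rewrite s2x.
  by exists k, (Ordinal jn); exact: (wit (Ordinal jn)).
- move=> i j; rewrite ltnS leq_eqVlt => /predU1P[ik|iq] ij; last first.
    have [w iw wle] := Jl i j iq ij; exists w => //.
    by apply: le_trans wle _; rewrite -s2x.
  have ek : i = k by apply: val_inj.
  have cj : cl j != 0 by rewrite -(same i j) // ek.
  by exists `|cl j|; [rewrite ek; exact: wit | exact: Rle].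
- move=> i j ij; rewrite !dE -(same i j ij); case: ifP => [ci|ci].
    left; exists k; rewrite !invrK; split; apply: wit => //.
    by rewrite -(same i j ij).
  case: (Jd i j ij) => [|[qi qj]]; first by left.
  (* The source reaches itself, so an index that it does not reach is another. *)
  right; rewrite !ltn_neqAle qi qj !andbT.
  have cj : (cl j != 0) = false by rewrite -(same i j ij).
  split; [move: ci | move: cj]; apply: contraFneq => e.
    by have <- : k = i by apply: val_inj.
  by have <- : k = j by apply: val_inj.
Qed.

End Algorithm.

(** Full row rank gives [m <= n], so that all other monomials are dominated by the
    two in the bound. *)
Lemma cost_bound (N : nat -> nat) : (N 0 <= N 1)%N -> (0 < N 1)%N ->
  (tcost N algorithm <= 2000 * (N 1 ^ 2 * N 0 ^ 2 + N 1 ^ 3))%N.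
Proof.
rewrite /=; move: (N 0%N) (N 1%N) => m n mn n0.
rewrite !expnS !expn0 !muln1.
have h1 : (n * n <= n * (n * n))%N by nia.
have h2 : (n <= n * n)%N by nia.
have h3 : (m * n <= n * n)%N by nia.
have h4 : (m * m <= n * n)%N by nia.
have h5 : (m * m * n <= n * (n * n))%N by nia.
have h6 : (m * n * n <= n * (n * n))%N by nia.
lia.
Qed.

(** Without rows the condition number is 0, which is why the program then resets
    its estimate to 0. *)
Lemma wproj_no_row (R : realType) m n (A : 'M[R]_(m, n)) D :
  m = 0%N -> wproj A D = 0.
Proof.
move=> m0; have -> : A = 0 by apply/matrixP => -[i im]; exfalso; rewrite m0 in im.
by rewrite /wproj mulmx0 mul0mx.
Qed.

Theorem theorem2p5 (R : realType) :
  exists (p : cmd) (C : nat),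
  forall (m n : nat) (A : 'M[R]_(m, n)), (3 <= n)%N -> row_free A ->
  forall s : state R, input A s ->
  exists (t : nat) (s' : state R),
    [/\ exec p s t s',
        (t <= C * (n ^ 2 * m ^ 2 + n ^ 3))%N
      & let W := kerset A in
        let xi := output_xi s' in
        let D := output_diag n s' in
        [/\ ((xi%:E <= chibarW W)%E /\
             (chibarW W <= n%:R%:E * chibar_star W ^+ 2 * xi%:E)%E),
            posdiag D
          & ((chibar_star W <= chibarW (mulmx D @` W)%classic)%E /\
             (chibarW (mulmx D @` W)%classic <=
                n%:R%:E * chibar_star W ^+ 3)%E)]].
Proof.
exists (compile algorithm), 2000%N => m n A n3 Af s [sm sn sA].
have n0 : (0 < n)%N by exact: leq_trans n3.
have mn : (m <= n)%N by move: Af; rewrite /row_free => /eqP <-; exact: rank_leq_col.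
have [t et tle] := @exec_compile R algorithm s isT.
exists t, (sem algorithm s); split=> //.
  apply: leq_trans tle _; have := @cost_bound (imem s 0).
  by rewrite sm sn; apply.
have sMA : stored m n s = A by apply/matrixP => r c; rewrite mxE sA.
rewrite /algorithm !sem_seq.
set s1 := sem gauss_jordan s; set s2 := sem (PRSet _ _ _) s1; set s3 := sem all_sources s2.
have [] := @gauss_jordanP R m n s A sm sn Af; first by rewrite sMA.
rewrite -/s1 => kM Mb.
have s2M : stored m n s2 = stored m n s1.
  by apply/matrixP => r c; rewrite !mxE /s2 sem_rmem.
have s20 : imem s2 0 = imem s 0 by rewrite /s2 !sem_dims.
have Mf : row_free (stored m n s1) by exact: row_free_kerset Af kM.
have s2x : rmem s2 est 0 = 1 by rewrite /s2 sem_rset rmem_rset update_same.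
have := @all_sourcesP R m n s2; rewrite -/s3 s2M s20 => /(_ sm sn n0 Mf Mb s2x).
case.
move: (stored m n s1) kM Mb Mf {s2M} => M kM Mb Mf Mx Ml Md.
pose d := scale_row n s3.
have d0 i : 0 < d 0 i.
  have [r [/ratio_witness_gt0]] := Md i i (or_introl erefl).
  by rewrite invr_gt0.
set s4 := sem _ s3.
have -> : output_diag n s4 = diag_mx d.
  by rewrite /output_diag /s4; congr diag_mx; apply/rowP => j; rewrite !mxE sem_rmem.
have dp := diag_posdiag d0.
rewrite -kM; split=> //; last first.
  split; first by apply: ereal_inf_lbound; exists (diag_mx d).
  rewrite chibarW_scale //; case: (posnP m) => [m0|m0]; last exact: chibar_scale_le.
  apply: le_trans (chibar_le_entry (lexx 0) _) _.
    by move=> D' i j _; rewrite wproj_no_row // mxE normr0.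
  rewrite mulr0 mule_ge0 // expe_ge0 //.
  apply: le_ereal_inf_tmp => _ [D' /posdiagP[e -> e0] <-].
  by rewrite chibarW_scale // chibar_ge0.
have xiE : output_xi s4 = if (m <= 0)%N then 0 else rmem s3 1 0.
  rewrite /output_xi /s4 sem_if sem_rset [beval _ _]/= /s3 sem_dims // s20 sm.
  by case: ifP => // _; rewrite rmem_rset update_same.
rewrite chibarW_kerset // xiE leqn0; case: (posnP m) => [m0|m0].
  split; first exact: chibar_ge0.
  rewrite mule0; apply: le_trans (chibar_le_entry (lexx 0) _) _.
    by move=> D' i j _; rewrite wproj_no_row // mxE normr0.
  by rewrite mulr0.
split; last exact: chibar_le_estimate.
by have [i [j]] := Mx; exact: ratio_witness_le.
Qed.
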